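(* Let $X$ and $Y$ be Banach spaces, let $1\le p<\infty$ and $p\le q\le\infty$ with $(p,q)\ne(1,\infty)$. Then $\mathcal K(\ell_p(X),\ell_q(Y))$ is isomorphic to $C([1,\omega],\mathcal K(\ell_p(X),\ell_q(Y)))$.
   Context: $\mathcal K(E,F)$ is the Banach space of compact linear operators from $E$ to $F$ with the operator norm. For $1\le p<\infty$, $\ell_p(X)$ is the space of sequences $(x_n)$ in $X$ with norm $(\sum_n\|x_n\|^p)^{1/p}<\infty$; $\ell_\infty(X)$ is the space of bounded sequences in $X$ with the supremum norm. $[1,\omega]$ is the compact space of ordinals between $1$ and $\omega$ in the order topology, and $C(K,E)$ is the Banach space of continuous functions from the compact Hausdorff space $K$ to the Banach space $E$ with the supremum norm. ''Isomorphic'' means linearly homeomorphic. *)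

(* Defs.v *)
From HB Require Import structures.
From mathcomp Require Import all_boot all_order all_algebra complex.
From mathcomp Require Import all_classical all_reals all_analysis ess_sup_inf.

Set Implicit Arguments.
Unset Strict Implicit.
Unset Printing Implicit Defensive.

Import Order.TTheory GRing.Theory Num.Theory.
Import numFieldNormedType.Exports.

Local Open Scope classical_set_scope.
Local Open Scope ring_scope.

Variant scalar_kind := Real_scalars | Complex_scalars.

Definition scalars (R : realType) (k : scalar_kind) : numFieldType :=
  if k is Complex_scalars then (R[i] : numFieldType) else (R : numFieldType).

Section real_valued_norm.
Variables (R : realType) (k : scalar_kind).
Local Notation K := (scalars R k).

(* In a [normedModType K] the norm takes its values in [K]; these two maps pass
   between its (real, nonnegative) values and [R]. *)
Definition scalar_re : K -> R :=
  match k return scalars R k -> R with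
  | Real_scalars => fun x => x
  | Complex_scalars => fun z => complex.Re z
  end.

Definition scalar_of : R -> K :=
  match k return R -> scalars R k with
  | Real_scalars => fun x => x
  | Complex_scalars => fun x => (x%:C)%C
  end.

Definition rnorm (V : normedModType K) (x : V) : R := scalar_re `|x|.

Lemma scalar_ofK : cancel scalar_of scalar_re.
Proof. by rewrite /scalar_of /scalar_re; case: k. Qed.

Lemma scalar_of0 : scalar_of 0 = 0.
Proof. by rewrite /scalar_of; case: k. Qed.

Lemma scalar_ofD x y : scalar_of (x + y) = scalar_of x + scalar_of y.
Proof. by rewrite /scalar_of; case: k => //=; rewrite rmorphD. Qed.

Lemma scalar_ofM x y : scalar_of (x * y) = scalar_of x * scalar_of y.
Proof. by rewrite /scalar_of; case: k => //=; rewrite rmorphM. Qed.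

Lemma ler_scalar_of x y : (scalar_of x <= scalar_of y) = (x <= y).
Proof. by rewrite /scalar_of; case: k => //=; rewrite lecR. Qed.

Lemma ltr_scalar_of x y : (scalar_of x < scalar_of y) = (x < y).
Proof. by rewrite /scalar_of; case: k => //=; rewrite ltcR. Qed.

Lemma scalar_reK (x : K) : 0 <= x -> scalar_of (scalar_re x) = x.
Proof.
rewrite /scalar_of /scalar_re; case: k x => //= -[a b] /=.
by rewrite lecE /= => /andP[/eqP -> _].
Qed.

Lemma normr_rnorm (V : normedModType K) (x : V) : `|x| = scalar_of (rnorm x).
Proof. by rewrite /rnorm scalar_reK. Qed.

Lemma rnorm_ge0 (V : normedModType K) (x : V) : 0 <= rnorm x.
Proof. by rewrite -ler_scalar_of -normr_rnorm scalar_of0. Qed.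

Lemma ler_rnormD (V : normedModType K) (x y : V) :
  rnorm (x + y) <= rnorm x + rnorm y.
Proof.
by rewrite -ler_scalar_of scalar_ofD -!normr_rnorm ler_normD.
Qed.

Lemma rnormZ (V : normedModType K) (a : K) (x : V) :
  rnorm (a *: x) = scalar_re `|a| * rnorm x.
Proof.
apply: (can_inj scalar_ofK).
by rewrite scalar_ofM (scalar_reK (normr_ge0 a)) -!normr_rnorm normrZ.
Qed.

Lemma scalar_re_norm_ge0 (a : K) : 0 <= scalar_re `|a|.
Proof. by rewrite -ler_scalar_of scalar_reK// scalar_of0. Qed.

Lemma rnorm0 (V : normedModType K) : rnorm (0 : V) = 0.
Proof. by apply: (can_inj scalar_ofK); rewrite -normr_rnorm normr0 scalar_of0. Qed.

Lemma rnorm0_eq0 (V : normedModType K) (x : V) : rnorm x = 0 -> x = 0.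
Proof. by move=> x0; apply/normr0_eq0; rewrite normr_rnorm x0 scalar_of0. Qed.

Lemma rnormN (V : normedModType K) (x : V) : rnorm (- x) = rnorm x.
Proof. by rewrite /rnorm normrN. Qed.

Lemma rnorm_dist (V : normedModType K) (x y : V) :
  `|rnorm x - rnorm y| <= rnorm (x - y).
Proof.
have h (a b : V) : rnorm a - rnorm b <= rnorm (a - b).
  by rewrite lerBlDr -[in leLHS](subrK b a) ler_rnormD.
rewrite ler_norml h andbT lerNl opprB (le_trans (h y x))//.
by rewrite -rnormN opprB.
Qed.

Lemma rnorm_continuous (V : normedModType K) : continuous (@rnorm V).
Proof.
move=> x; apply/cvgrPdist_lt => e e0.
apply/nbhs_normP; exists (scalar_of e) => /=.
  by rewrite -scalar_of0 ltr_scalar_of.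
move=> y /=; rewrite normr_rnorm ltr_scalar_of.
exact/le_lt_trans/rnorm_dist.
Qed.

Lemma compact_rnorm_bounded (V : normedModType K) (A : set V) :
  compact A -> exists M : R, forall x, A x -> rnorm x <= M.
Proof.
move=> cA; have /compact_bounded[M [_ hM]] : compact (@rnorm V @` A).
  by apply: continuous_compact => //; exact/continuous_subspaceT/rnorm_continuous.
exists (M + 1) => x Ax; rewrite -[leLHS]ger0_norm ?rnorm_ge0//.
by apply: (hM (M + 1)); [rewrite ltrDl|exists x].
Qed.

End real_valued_norm.

Section Lnorm_counting_facts.
Variable R : realType.
Implicit Types (u v : nat -> R) (p : \bar R).
Local Open Scope ereal_scope.
Local Notation "'N_ p [ u ]" := ('N[counting]_p[EFin \o u]).

Let counting_setT : 0 < counting [set: nat] :> \bar R.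
Proof. by rewrite /counting asboolF//; exact: infinite_nat. Qed.

Let counting_ae (P : nat -> Prop) :
  (\forall x \ae (@counting nat R), P x) -> forall x, P x.
Proof.
move=> [A [mA A0 PA]] x; apply: contrapT => nPx.
have Ax : A x by exact: PA.
move: A0; rewrite /= /counting; case: ifPn => // /asboolP finA [] /eqP.
rewrite pnatr_eq0 finmap.cardfs_eq0 => /eqP A0.
by have /(fset_set_set0 finA) A00 := A0; rewrite A00 in Ax.
Qed.

Lemma Lnorm_counting_pinfty u :
  'N_+oo[u] = ereal_sup (range (fun n => `|u n|%:E)).
Proof.
rewrite unlock /Lnorm counting_setT; apply/eqP; rewrite eq_le; apply/andP; split.
  apply/ess_supP/nearW => n /=.
  by apply: ereal_sup_ubound; exists n.
apply: ge_ereal_sup => _ [n _ <-].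
exact: (counting_ae (ess_sup_ge counting (abse \o (EFin \o u)))).
Qed.

Lemma Lnorm_counting_fin (p : R) u : (0 < p)%R ->
  'N_p%:E[u] = (\sum_(n <oo) (`|u n| `^ p)%:E) `^ p^-1.
Proof. by move=> p0; rewrite Lnorm_counting. Qed.

Lemma le_Lnorm_counting p u v : 0 < p ->
  (forall n, 0 <= u n <= v n)%R -> 'N_p[u] <= 'N_p[v].
Proof.
move=> p0 uv.
have uv' n : (`|u n| <= `|v n|)%R.
  have /andP[u0 uvn] := uv n.
  by rewrite !ger0_norm//; exact: le_trans uvn.
case: p p0 => [p p0| |//].
- rewrite lte_fin in p0; rewrite !Lnorm_counting_fin//.
  have S0 (w : nat -> R) : 0 <= \sum_(n <oo) (`|w n| `^ p)%:E.
    by rewrite nneseries_ge0// => n _ _; rewrite lee_fin powR_ge0.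
  apply: gt0_ler_poweR; rewrite ?in_itv/= ?leey ?andbT ?S0 ?invr_ge0 ?(ltW p0)//.
  apply: lee_nneseries => n *; first by rewrite lee_fin powR_ge0.
  by rewrite lee_fin ge0_ler_powR ?nnegrE// ltW.
- move=> _; rewrite !Lnorm_counting_pinfty.
  apply: ge_ereal_sup => _ [n _ <-].
  apply: le_trans (ereal_sup_ubound _); last by exists n.
  by rewrite lee_fin.
Qed.

Lemma Lnorm_countingZ p (c : R) u : 0 < p -> (0 <= c)%R ->
  'N_p[(fun n => c * u n)%R] = c%:E * 'N_p[u].
Proof.
case: p => [p p0 c0| _ c0 |//].
- rewrite lte_fin in p0; rewrite !Lnorm_counting_fin//.
  rewrite (_ : \sum_(n <oo) _ = (c `^ p)%:E * \sum_(n <oo) (`|u n| `^ p)%:E).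
    rewrite poweRM ?lee_fin ?powR_ge0//; last first.
      by apply: nneseries_ge0 => n _ _; rewrite lee_fin powR_ge0.
    by rewrite poweR_EFin -powRrM mulfV ?gt_eqF// powRr1.
  rewrite -nneseriesZl//.
  apply: eq_eseriesr => n _.
  by rewrite normrM powRM// (ger0_norm c0) EFinM.
- rewrite unlock /Lnorm counting_setT -ess_supZl//.
  by congr ess_sup; apply/funext => n /=; rewrite normrM (ger0_norm c0).
Qed.

Lemma Lnorm_counting_eq0 p u : 0 < p -> 'N_p[u] = 0 -> forall n, u n = 0%R.
Proof.
move=> p0 Nu0 n.
apply: (counting_ae (P := fun n => u n = 0%R)).
apply: filterS (@Lnorm_eq0_eq0 _ _ R counting (EFin \o u) p _ p0 Nu0) => //.
by move=> m /(_ I) [].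
Qed.

End Lnorm_counting_facts.


Section sup_rnorm.
Variables (R : realType) (k : scalar_kind) (S : Type).
Variables (V : normedModType (scalars R k)) (A : set S).
Implicit Types f g : S -> V.

Definition sup_rnorm f : R := sup [set rnorm (f x) | x in A].

Definition rnorm_bounded f := exists M : R, forall x, A x -> rnorm (f x) <= M.

Lemma sup_rnorm_ub f : rnorm_bounded f ->
  forall x, A x -> rnorm (f x) <= sup_rnorm f.
Proof.
move=> [M fM] x Ax; apply: ub_le_sup; last by exists x.
by exists M => _ [y Ay <-]; exact: fM.
Qed.

Lemma sup_rnorm_le f M : 0 <= M -> (forall x, A x -> rnorm (f x) <= M) ->
  sup_rnorm f <= M.
Proof.
move=> M0 fM; rewrite /sup_rnorm.
have [->|/set0P A0] := eqVneq [set rnorm (f x) | x in A] set0.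
  by rewrite sup0.
by apply: ge_sup => // _ [x Ax <-]; exact: fM.
Qed.

Lemma sup_rnorm_ge0 f : rnorm_bounded f -> 0 <= sup_rnorm f.
Proof.
move=> bf; have [A0|/set0P[x Ax]] := eqVneq A set0.
  by rewrite /sup_rnorm A0 image_set0 sup0.
exact: le_trans (rnorm_ge0 _) (sup_rnorm_ub bf Ax).
Qed.

Lemma sup_rnormD f g : rnorm_bounded f -> rnorm_bounded g ->
  sup_rnorm (f + g) <= sup_rnorm f + sup_rnorm g.
Proof.
move=> bf bg; apply: sup_rnorm_le => [|x Ax].
  by rewrite addr_ge0// sup_rnorm_ge0.
by apply: le_trans (ler_rnormD _ _) _; rewrite lerD// sup_rnorm_ub.
Qed.

Lemma sup_rnormZ a f : rnorm_bounded f ->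
  sup_rnorm (a *: f) = scalar_re `|a| * sup_rnorm f.
Proof.
move=> bf; have a0 := scalar_re_norm_ge0 a.
have ble x : A x -> rnorm ((a *: f) x) <= scalar_re `|a| * sup_rnorm f.
  by move=> Ax; rewrite rnormZ ler_wpM2l// sup_rnorm_ub.
have baf : rnorm_bounded (a *: f) by exists (scalar_re `|a| * sup_rnorm f).
apply/eqP; rewrite eq_le sup_rnorm_le ?mulr_ge0 ?sup_rnorm_ge0//=.
have [a00|a00] := eqVneq 0 (scalar_re `|a|).
  by rewrite -a00 mul0r sup_rnorm_ge0.
have {a00}a0 : 0 < scalar_re `|a| by rewrite lt_neqAle a00.
rewrite -ler_pdivlMl// sup_rnorm_le// => [|x Ax].
  by rewrite mulr_ge0 ?invr_ge0 ?(ltW a0)// sup_rnorm_ge0.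
by rewrite ler_pdivlMl// -rnormZ; exact: (sup_rnorm_ub baf).
Qed.

Lemma sup_rnorm_eq0 f : rnorm_bounded f -> sup_rnorm f = 0 ->
  forall x, A x -> f x = 0.
Proof.
move=> bf f0 x Ax; apply/rnorm0_eq0/eqP.
by rewrite eq_le rnorm_ge0 andbT -f0 sup_rnorm_ub.
Qed.

End sup_rnorm.

Section ell.
Variables (R : realType) (k : scalar_kind) (p : \bar R) (hp : (1 <= p)%E).
Variable X : normedModType (scalars R k).
Local Notation K := (scalars R k).

(* The norm of $\ell_p(X)$ as an element of [0, +oo]: by [Lnorm_counting_fin]
   and [Lnorm_counting_pinfty] it is (\sum_n |x n|^p)^(1/p) for finite p and
   sup_n |x n| for p = +oo. *)
Definition ell_enorm (x : nat -> X) : \bar R :=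
  'N[counting]_p[EFin \o (fun n => rnorm (x n))]%E.

Definition ell_pred of (1 <= p)%E : {pred nat -> X} :=
  [pred x | `[< (ell_enorm x < +oo)%E >]].

Let p0 : (0 < p)%E. Proof. exact: lt_le_trans hp. Qed.

Lemma ell_enormD (x y : nat -> X) :
  (ell_enorm (x + y)%R <= ell_enorm x + ell_enorm y)%E.
Proof.
apply: (@le_trans _ _ 'N[counting]_p[EFin \o
    ((fun n => rnorm (x n)) \+ (fun n => rnorm (y n)))%R]%E).
  by apply: le_Lnorm_counting => // n; rewrite rnorm_ge0 ler_rnormD.
exact: eminkowski.
Qed.

Lemma ell_enormZ (a : K) (x : nat -> X) :
  ell_enorm (a *: x) = ((scalar_re `|a|)%:E * ell_enorm x)%E.
Proof.
rewrite -Lnorm_countingZ ?scalar_re_norm_ge0//.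
by congr Lnorm; apply/funext => n /=; rewrite rnormZ.
Qed.

Lemma ell_enorm0_eq0 x : ell_enorm x = 0%E -> x = 0.
Proof.
move=> x0; apply/funext => n; apply: rnorm0_eq0.
exact: (Lnorm_counting_eq0 p0 x0).
Qed.

Lemma ell_submod_closed : submod_closed (ell_pred hp).
Proof.
split=> [|a x y]; rewrite ?inE.
  have := ell_enormZ 0 0.
  by rewrite scale0r normr0 -(scalar_of0 R k) scalar_ofK mul0e => ->.
move=> xoo yoo.
apply: le_lt_trans (ell_enormD _ _) _.
by rewrite ell_enormZ lte_add_pinfty// lte_mul_pinfty// lee_fin scalar_re_norm_ge0.
Qed.

HB.instance Definition _ :=
  GRing.isSubmodClosed.Build K (nat -> X) (ell_pred hp) ell_submod_closed.

Record ell : Type := Ell { ell_val :> nat -> X; _ : ell_val \in ell_pred hp }.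

HB.instance Definition _ := [isSub for ell_val].
HB.instance Definition _ := [Choice of ell by <:].
HB.instance Definition _ := [SubChoice_isSubLmodule of ell by <:].

Definition ell_norm (x : ell) : R := fine (ell_enorm x).

Lemma ell_normE (x : ell) : (ell_norm x)%:E = ell_enorm x.
Proof.
rewrite fineK// ge0_fin_numE ?Lnorm_ge0//.
by case: x => x /=; rewrite inE.
Qed.

Let ell_normD (x y : ell) :
  scalar_of k (ell_norm (x + y)) <= scalar_of k (ell_norm x) + scalar_of k (ell_norm y).
Proof.
by rewrite -scalar_ofD ler_scalar_of -lee_fin EFinD !ell_normE ell_enormD.
Qed.

Let ell_normZ (a : K) (x : ell) :
  scalar_of k (ell_norm (a *: x)) = `|a| * scalar_of k (ell_norm x).
Proof.
rewrite -(scalar_reK (normr_ge0 a)) -scalar_ofM; congr (scalar_of k).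
by apply: EFin_inj; rewrite EFinM !ell_normE ell_enormZ.
Qed.

Let ell_norm0_eq0 (x : ell) : scalar_of k (ell_norm x) = 0 -> x = 0.
Proof.
rewrite -(scalar_of0 R k) => /(can_inj (@scalar_ofK R k)) x0; apply/val_inj.
by apply: ell_enorm0_eq0; rewrite -ell_normE x0.
Qed.

HB.instance Definition _ :=
  Lmodule_isNormed.Build K ell ell_normD ell_normZ ell_norm0_eq0.

End ell.

Section compact_operators.
Variables (R : realType) (k : scalar_kind).
Local Notation K := (scalars R k).
Variables E F : normedModType K.

Definition unit_ball : set E := [set x | `|x| <= 1].

Definition is_compact_op (T : E -> F) :=
  linear T /\ precompact (T @` unit_ball).

Definition compact_op_pred : {pred E -> F} := [pred T | `[< is_compact_op T >]].

Lemma is_compact_op_bounded T : is_compact_op T -> rnorm_bounded unit_ball T.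
Proof.
move=> [_ [B TB [/compact_rnorm_bounded[M BM] _]]].
by exists M => x x1; apply/BM/TB; exists x.
Qed.

Lemma compact_op_submod_closed : submod_closed compact_op_pred.
Proof.
split=> [|a S T]; rewrite ?inE.
  split=> [b x y|]; first by rewrite scaler0 addr0.
  exists [set 0]; first by move=> _ [x _ <-].
  by split; [exact: compact_set1|apply: compact_closed (@compact_set1 _ _); exact: norm_hausdorff].
move=> [linS [A SA [cA _]]] [linT [B TB [cB _]]].
split=> [b x y|].
  rewrite !fctE linS linT !scalerDr !scalerA (mulrC a b) !addrA; congr (_ + _).
  by rewrite -!addrA; congr (_ + _); rewrite addrC.
have h : continuous (fun z : F * F => a *: z.1 + z.2).
  move=> z; apply: cvgD; last exact: cvg_snd.
  by apply: cvgZl_tmp; exact: cvg_fst.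
exists [set a *: z.1 + z.2 | z in A `*` B].
  by move=> _ [x x1 <-]; exists (S x, T x) => //; split; [apply: SA|apply: TB]; exists x.
have cAB : compact [set a *: z.1 + z.2 | z in A `*` B].
  by apply: continuous_compact; [exact: continuous_subspaceT|exact: compact_setX].
by split=> //; apply: compact_closed => //; exact: norm_hausdorff.
Qed.

HB.instance Definition _ :=
  GRing.isSubmodClosed.Build K (E -> F) compact_op_pred compact_op_submod_closed.

Record compact_op : Type :=
  CompactOp { op_val :> E -> F; _ : op_val \in compact_op_pred }.

HB.instance Definition _ := [isSub for op_val].
HB.instance Definition _ := [Choice of compact_op by <:].
HB.instance Definition _ := [SubChoice_isSubLmodule of compact_op by <:].

Definition op_norm (T : compact_op) : R := sup_rnorm unit_ball T.

Lemma compact_opP (T : compact_op) : is_compact_op T.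
Proof. by case: T => T /=; rewrite inE. Qed.

Let op_bounded (T : compact_op) : rnorm_bounded unit_ball T.
Proof. exact/is_compact_op_bounded/compact_opP. Qed.

Let op_normD (S T : compact_op) :
  scalar_of k (op_norm (S + T)) <= scalar_of k (op_norm S) + scalar_of k (op_norm T).
Proof. by rewrite -scalar_ofD ler_scalar_of; exact: sup_rnormD. Qed.

Let op_normZ (a : K) (T : compact_op) :
  scalar_of k (op_norm (a *: T)) = `|a| * scalar_of k (op_norm T).
Proof.
rewrite -(scalar_reK (normr_ge0 a)) -scalar_ofM; congr (scalar_of k).
exact: sup_rnormZ.
Qed.

Let op_norm0_eq0 (T : compact_op) : scalar_of k (op_norm T) = 0 -> T = 0.
Proof.
rewrite -(scalar_of0 R k) => /(can_inj (@scalar_ofK R k)) T0; apply/val_inj.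
apply/funext => x /=; have [linT _] := compact_opP T.
pose L : {linear E -> F} := HB.pack (T : E -> F) (GRing.isLinear.Build _ _ _ _ _ linT).
have T00 : T 0 = 0 := linear0 L.
have [->//|x0] := eqVneq x 0.
have : T (`|x|^-1 *: x) = 0.
  apply: (sup_rnorm_eq0 (op_bounded T) T0).
  by rewrite /unit_ball/= normrZ ger0_norm ?invr_ge0// mulVf// normr_eq0.
have := linT `|x|^-1 x 0; rewrite !addr0 T00 addr0 => -> /eqP.
by rewrite scaler_eq0 invr_eq0 normr_eq0 (negPf x0) => /eqP.
Qed.

HB.instance Definition _ :=
  Lmodule_isNormed.Build K compact_op op_normD op_normZ op_norm0_eq0.

End compact_operators.

Section continuous_functions.
Variables (R : realType) (k : scalar_kind).
Local Notation K := (scalars R k).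
Variables (S : topologicalType) (cS : compact [set: S]) (E : normedModType K).

Definition cfun_pred of compact [set: S] : {pred S -> E} :=
  [pred f : S -> E | `[< continuous f >]].

Lemma cfun_submod_closed : submod_closed (cfun_pred cS).
Proof.
split=> [|a f g]; rewrite ?inE.
  by move=> x; exact: cvg_cst.
move=> cf cg x.
by apply: cvgD; [apply: cvgZl_tmp; exact: cf|exact: cg].
Qed.

HB.instance Definition _ :=
  GRing.isSubmodClosed.Build K (S -> E) (cfun_pred cS) cfun_submod_closed.

(* $C(S, E)$: the compactness of $S$ makes the supremum norm finite. *)
Record cfun : Type := CFun { cfun_val :> S -> E; _ : cfun_val \in cfun_pred cS }.

HB.instance Definition _ := [isSub for cfun_val].
HB.instance Definition _ := [Choice of cfun by <:].
HB.instance Definition _ := [SubChoice_isSubLmodule of cfun by <:].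

Definition cfun_norm (f : cfun) : R := sup_rnorm [set: S] f.

Lemma cfunP (f : cfun) : continuous f.
Proof. by case: f => f /=; rewrite inE. Qed.

Let cfun_bounded (f : cfun) : rnorm_bounded [set: S] f.
Proof.
have /compact_rnorm_bounded[M fM] : compact (f @` [set: S]).
  by apply: continuous_compact => //; exact/continuous_subspaceT/cfunP.
by exists M => x _; apply: fM; exists x.
Qed.

Let cfun_normD (f g : cfun) :
  scalar_of k (cfun_norm (f + g)) <=
  scalar_of k (cfun_norm f) + scalar_of k (cfun_norm g).
Proof. by rewrite -scalar_ofD ler_scalar_of; exact: sup_rnormD. Qed.

Let cfun_normZ (a : K) (f : cfun) :
  scalar_of k (cfun_norm (a *: f)) = `|a| * scalar_of k (cfun_norm f).
Proof.
rewrite -(scalar_reK (normr_ge0 a)) -scalar_ofM; congr (scalar_of k).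
exact: sup_rnormZ.
Qed.

Let cfun_norm0_eq0 (f : cfun) : scalar_of k (cfun_norm f) = 0 -> f = 0.
Proof.
rewrite -(scalar_of0 R k) => /(can_inj (@scalar_ofK R k)) f0; apply/val_inj.
by apply/funext => x; exact: (sup_rnorm_eq0 (cfun_bounded f) f0).
Qed.

HB.instance Definition _ :=
  Lmodule_isNormed.Build K cfun cfun_normD cfun_normZ cfun_norm0_eq0.

End continuous_functions.

(* The ordinals up to omega: [Some n] is the finite ordinal n, [None] is omega. *)
Definition ordinal_le_omega := option nat.

Definition finite_ordinal (n : nat) : ordinal_le_omega := Some n.
Definition omega : ordinal_le_omega := None.

Section ordinals.

HB.instance Definition _ := Choice.on ordinal_le_omega.

Definition le_ordinal (x y : ordinal_le_omega) : bool :=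
  match x, y with
  | _, None => true
  | None, Some _ => false
  | Some m, Some n => (m <= n)%N
  end.

Let le_ordinal_refl : reflexive le_ordinal.
Proof. by case=> /=. Qed.

Let le_ordinal_anti : antisymmetric le_ordinal.
Proof. by move=> [m|] [n|] //= /anti_leq ->. Qed.

Let le_ordinal_trans : transitive le_ordinal.
Proof. by move=> [m|] [n|] [l|] //=; exact: leq_trans. Qed.

HB.instance Definition _ := Order.Le_isPOrder.Build
  (Order.Disp tt tt) ordinal_le_omega le_ordinal_refl le_ordinal_anti le_ordinal_trans.

Let le_ordinal_total : total (<=%O : rel ordinal_le_omega).
Proof. by move=> [m|] [n|] //=; exact: leq_total. Qed.

HB.instance Definition _ := Order.POrder_isTotal.Build
  (Order.Disp tt tt) ordinal_le_omega le_ordinal_total.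

End ordinals.

Definition itv_1_omega :=
  {x : ordinal_le_omega | x \in `[finite_ordinal 1, omega]%O}.

HB.instance Definition _ := SubChoice.on itv_1_omega.
HB.instance Definition _ := [Order of itv_1_omega by <:].


Lemma compact_1_omega : compact [set: order_topology itv_1_omega].
Proof.
rewrite compact_ultra => U UF _.
have [[a Ua]|noU] := pselect (exists a, U [set a]).
  by exists a; split => // B /nbhs_singleton Ba; apply: filterS Ua => _ ->.
have tail (m : nat) : U [set x | (finite_ordinal m <= val x)%O].
  elim: m => [|m ih].
    by apply: filterS filterT => -[[n|] ? _].
  have [Ue|Ue] := in_ultra_setVsetC [set x | val x = finite_ordinal m] UF.
    have [[a /= am]|na] := pselect (exists a : itv_1_omega, val a = finite_ordinal m).
      exfalso; apply: noU; exists a; apply: filterS Ue => x /= xm.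
      exact/val_inj/(etrans xm (esym am)).
    by apply: filterS Ue => x /= xm; exfalso; apply: na; exists x.
  apply: filterS (filterI ih Ue) => -[[n|] ?] //= [mn nm].
  by apply: contrapT => /negP; rewrite -leqNgt => nm'; apply: nm; congr Some; apply/anti_leq/andP.
have top : omega \in `[finite_ordinal 1, omega]%O by [].
pose w : order_topology itv_1_omega := exist _ omega top.
have lew (x : order_topology itv_1_omega) : (x <= w)%O by case: x => [[n|] ?].
exists w; split=> // B; rewrite itv_nbhsE => -[[l r] [oi /andP[lw wr]] iB].
have {}iB x : (l <= BLeft x)%O -> B x.
  by move=> lx; apply/iB/andP; split=> //; apply: le_trans wr; exact: lew.
case: l lw oi iB => [[] c|[]] lw oi iB.
- by case: r oi {wr} => [[]|[]].
- case: c lw oi iB => [[n|] cP] // lw _ iB.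
  apply: filterS (tail n.+1) => x nx; apply: iB; rewrite bnd_simp ltNge.
  by case: x nx => [[m|] ?] //= nm; rewrite -ltnNge.
- by apply: filterS filterT => x _; apply: iB.
- by [].
Qed.

Definition isomorphic (K : numFieldType) (E F : normedModType K) :=
  exists (f : {linear E -> F}) (g : F -> E),
    [/\ cancel f g, cancel g f, continuous f & continuous g].

(* Main.v *)
(* Put Z = K(l_p(X), l_q(Y)) and split the index set of sequences into infinitely
   many infinite blocks, so that l_r(V) = l_r(l_r(V)). Since p <= q, a null
   sequence (T_n) of Z gives a compact block diagonal operator of norm
   sup |T_n|. Conversely the diagonal blocks of a compact operator S tend to 0:
   for q < oo because the blocks of a single y in l_q(Y) do, for p > 1 because
   averages of unit vectors from disjoint blocks of l_p(X) tend to 0. Hence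
   c_0(Z) is a complemented subspace of Z, say Z = c_0(Z) + W. As
   W + c_0(W) = c_0(W), Pelczynski's argument gives
   Z = W + c_0(c_0(Z) + W) = c_0(c_0(Z)) + c_0(W) = c_0(Z), which is isomorphic
   to the space C([1,omega],Z) of convergent sequences of Z. *)

Require Import Defs.
From HB Require Import structures.
From Stdlib Require Cantor.
From mathcomp Require Import all_boot all_order all_algebra finmap.
From mathcomp Require Import lra.
From mathcomp Require Import all_classical all_reals all_analysis.

Set Implicit Arguments.
Unset Strict Implicit.
Unset Printing Implicit Defensive.

Import Order.TTheory GRing.Theory Num.Theory.
Import numFieldNormedType.Exports.

Local Open Scope classical_set_scope.
Local Open Scope ring_scope.

(** * Norms of scalar sequences *)

Arguments Cantor.to_nat : simpl never.
Arguments Cantor.of_nat : simpl never.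

Section Lnorm_sequences.
Variable R : realType.
Implicit Types (u v : nat -> R) (p q : \bar R) (r s : R).
Local Open Scope ereal_scope.
Local Notation "'N_ p [ u ]" := ('N[counting]_p[EFin \o u]).

(** For finite exponents, norms are compared through their r-th powers, as unordered sums that can
    be reindexed, split and regrouped. *)
Lemma Lnorm_counting_powE r u : (0 < r)%R ->
  'N_r%:E[u] `^ r = \esum_(n in [set: nat]) (`|u n| `^ r)%:E.
Proof.
move=> r0; rewrite Lnorm_counting_fin// -poweRrM mulVf ?gt_eqF//.
rewrite poweRe1; last by apply: nneseries_ge0 => n _ _; rewrite lee_fin powR_ge0.
by rewrite nneseries_esumT// => n; rewrite lee_fin powR_ge0.
Qed.

Lemma lee_poweR2r r (x y : \bar R) : (0 < r)%R -> 0 <= x -> 0 <= y ->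
  (x `^ r <= y `^ r) = (x <= y).
Proof.
move=> r0 x0 y0; apply/idP/idP => xy; last first.
  by apply: gt0_ler_poweR; rewrite ?in_itv/= ?leey ?x0 ?y0// ltW.
have rV : (r * r^-1 = 1)%R by rewrite mulfV ?gt_eqF.
rewrite -[x]poweRe1// -[y]poweRe1// -rV !poweRrM.
by apply: gt0_ler_poweR; rewrite ?in_itv/= ?leey ?poweR_ge0// invr_ge0 ltW.
Qed.

Lemma poweR_inj r (x y : \bar R) : (0 < r)%R -> 0 <= x -> 0 <= y ->
  x `^ r = y `^ r -> x = y.
Proof.
move=> r0 x0 y0 xy; apply/eqP.
by rewrite eq_le -(lee_poweR2r r0 x0 y0) -(lee_poweR2r r0 y0 x0) xy lexx.
Qed.

Lemma ge_Lnorm_counting p u (n : nat) : 0 < p -> (`|u n|)%:E <= 'N_p[u].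
Proof.
case: p => [r r0| _|//]; last first.
  by rewrite Lnorm_counting_pinfty; apply: ereal_sup_ubound; exists n.
rewrite lte_fin in r0; rewrite -(@lee_poweR2r r)// ?Lnorm_ge0 ?lee_fin//.
rewrite Lnorm_counting_powE// poweR_EFin.
apply: esum_ge; exists [set n]; first by split.
by rewrite fsbig_set1.
Qed.

(** Reindexing along [f] leaves the part of the sum of [u] over the image of [f]; this will bound
    the norm of a single block. *)
Lemma Lnorm_counting_comp_inj p u (f : nat -> nat) : 0 < p -> injective f ->
  'N_p[u \o f] <= 'N_p[u].
Proof.
case: p => [r r0| _|//] finj; last first.
  rewrite !Lnorm_counting_pinfty; apply: ge_ereal_sup => _ [n _ <-].
  by apply: ereal_sup_ubound; exists (f n).
rewrite lte_fin in r0; rewrite -(@lee_poweR2r r)// ?Lnorm_ge0//.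
rewrite !Lnorm_counting_powE//.
rewrite -(esum_image [set: nat] f (fun n => (`|u n| `^ r)%:E)); last first.
  by move=> x y _ _; exact: finj.
rewrite [leRHS](esumID [set f x | x in setT]); last by move=> n _; rewrite lee_fin powR_ge0.
by rewrite setTI leeDl// esum_ge0// => n _; rewrite lee_fin powR_ge0.
Qed.

Lemma Lnorm_counting_delta p (c : R) (n : nat) : 0 < p -> (0 <= c)%R ->
  'N_p[(fun m => if m == n then c else 0%R)] = c%:E.
Proof.
case: p => [r r0| _|//] c0.
  rewrite lte_fin in r0; apply: (poweR_inj r0); rewrite ?Lnorm_ge0 ?lee_fin//.
  rewrite Lnorm_counting_powE// poweR_EFin.
  rewrite (esumID [set n]) => [|m _]; last by rewrite lee_fin powR_ge0.
  rewrite setTI esum_set1 ?lee_fin ?powR_ge0// eqxx ger0_norm//.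
  rewrite esum1 ?adde0// => m [_ /= /eqP/negPf ->].
  by rewrite normr0 powR0// gt_eqF.
rewrite Lnorm_counting_pinfty; apply/eqP; rewrite eq_le; apply/andP; split.
  by apply: ge_ereal_sup => _ [m _ <-]; case: ifP; rewrite ?normr0 ?ger0_norm// lee_fin.
by apply: ereal_sup_ubound; exists n => //; rewrite eqxx ger0_norm.
Qed.

(** With c the norm for the exponent r, every |u n| is at most c, so |u n|^s <= c^(s-r) |u n|^r, and
    summation gives at most c^s. *)
Lemma Lnorm_counting_mono p q u : 0 < p -> p <= q -> 'N_q[u] <= 'N_p[u].
Proof.
case: q p => [s| |] [r| |]// r0; rewrite ?lte_fin in r0 *; last first.
- move=> _; rewrite Lnorm_counting_pinfty; apply: ge_ereal_sup => _ [n _ <-].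
  by apply: ge_Lnorm_counting; rewrite lte_fin.
rewrite lee_fin => rs; have s0 : (0 < s)%R := lt_le_trans r0 rs.
have := Lnorm_ge0 counting r%:E (EFin \o u).
case Nu : ('N_r%:E[u]) => [c| |]// c0; last by rewrite leey.
rewrite lee_fin in c0.
have uc n : (`|u n| <= c)%R by rewrite -lee_fin -Nu ge_Lnorm_counting// lte_fin.
rewrite -(@lee_poweR2r s) ?Lnorm_ge0 ?lee_fin// Lnorm_counting_powE//.
rewrite -(subrK r s) addrC.
have [c00|c00] := eqVneq c 0%R.
  rewrite esum1 ?poweR_ge0// => n _.
  have := uc n; rewrite c00 normr_le0 => /eqP ->.
  by rewrite normr0 powR0// gt_eqF// addrC subrK.
have powD x : (0 <= x)%R -> (x `^ (r + (s - r)) = x `^ (s - r) * x `^ r)%R.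
  by move=> x0; rewrite powRD 1?mulrC// addrC subrK gt_eqF.
under eq_esum do rewrite powD//.
rewrite poweR_EFin powD// EFinM -(poweR_EFin c r) -Nu Lnorm_counting_powE//.
rewrite -!nneseries_esumT; [|by move=> n; rewrite lee_fin ?mulr_ge0 ?powR_ge0..].
rewrite -nneseriesZl; last by move=> n _; rewrite lee_fin powR_ge0.
apply: lee_nneseries => n *; first by rewrite lee_fin mulr_ge0 ?powR_ge0.
rewrite -EFinM lee_fin ler_wpM2r ?powR_ge0//.
by rewrite ge0_ler_powR ?nnegrE// subr_ge0.
Qed.

(** For finite p the partial sums of the series are powers of norms of truncations; for p = +oo the
    entry n survives in the truncation at n+1. *)
Lemma Lnorm_counting_le_trunc p u (c : R) : 0 < p -> (0 <= c)%R ->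
  (forall N, 'N_p[(fun n => if (n < N)%N then u n else 0%R)] <= c%:E) ->
  'N_p[u] <= c%:E.
Proof.
case: p => [r r0| _|//] c0 uc; last first.
  rewrite Lnorm_counting_pinfty; apply: ge_ereal_sup => _ [n _ <-].
  apply: le_trans (uc n.+1).
  apply: le_trans (@ge_Lnorm_counting _ _ n _) => //=.
  by rewrite leqnn.
rewrite lte_fin in r0; rewrite -(@lee_poweR2r r) ?Lnorm_ge0 ?lee_fin//.
rewrite Lnorm_counting_powE// -nneseries_esumT; last first.
  by move=> n; rewrite lee_fin powR_ge0.
apply: lime_le; first by apply: is_cvg_nneseries => n _ _; rewrite lee_fin powR_ge0.
apply: nearW => N; have := uc N.
rewrite -(@lee_poweR2r r) ?Lnorm_ge0 ?lee_fin// => /(le_trans _); apply.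
rewrite Lnorm_counting_powE//.
apply: esum_ge; exists `I_N; first by split => //; exact: finite_II.
rewrite big_mkord -fsbig_ord le_eqVlt; apply/orP; left; apply/eqP.
by apply: eq_bigr => i _; rewrite ltn_ord.
Qed.

(** Tonelli along the Cantor pairing: a nonnegative double sum, or a supremum of suprema, is
    evaluated row by row. *)
Lemma Lnorm_counting_pair p u v : 0 < p -> (forall n, 0 <= v n)%R ->
  (forall n, 'N_p[(fun j => u (Cantor.to_nat (n, j)))] = (v n)%:E) ->
  'N_p[u] = 'N_p[v].
Proof.
case: p => [r r0| _|//] v0 uv; last first.
  rewrite !Lnorm_counting_pinfty; apply/eqP; rewrite eq_le; apply/andP; split.
    apply: ge_ereal_sup => _ [i _ <-].
    apply: (@le_trans _ _ (`|v (Cantor.of_nat i).1|)%:E); last first.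
      by apply: ereal_sup_ubound; exists (Cantor.of_nat i).1.
    rewrite (ger0_norm (v0 _)) -uv.
    rewrite -[in leLHS](Cantor.cancel_to_of i); case: (Cantor.of_nat i) => n j.
    exact: (@ge_Lnorm_counting _ (fun j => u (Cantor.to_nat (n, j)))).
  apply: ge_ereal_sup => _ [n _ <-]; rewrite (ger0_norm (v0 _)) -uv.
  rewrite Lnorm_counting_pinfty; apply: ge_ereal_sup => _ [j _ <-].
  by apply: ereal_sup_ubound; exists (Cantor.to_nat (n, j)).
rewrite lte_fin in r0.
apply: (poweR_inj r0); rewrite ?Lnorm_ge0//.
rewrite !Lnorm_counting_powE//.
under [RHS]eq_esum => n _.
  by rewrite (ger0_norm (v0 _)) -poweR_EFin -uv Lnorm_counting_powE//; over.
rewrite (esum_esum (J := fun=> setT)) => [|i j _ _]; last by rewrite lee_fin powR_ge0.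
rewrite (reindex_esum ([set: nat] `*`` (fun=> [set: nat])) _ Cantor.to_nat).
  by apply: eq_esum => -[n j].
split=> // [x y _ _ /(congr1 Cantor.of_nat)|y _].
  by rewrite !Cantor.cancel_of_to.
by exists (Cantor.of_nat y) => //; exact: Cantor.cancel_to_of.
Qed.

Lemma le_sum_Lnorm_counting r u (c : R) (B : {fset nat}) : (0 < r)%R ->
  (0 <= c)%R -> (forall n, n \in B -> c <= `|u n|)%R ->
  ((c `^ r) *+ #|` B|)%:E <= 'N_r%:E[u] `^ r.
Proof.
move=> r0 c0 Bc; rewrite Lnorm_counting_powE//.
apply: esum_ge; exists [set` B]; first by split.
rewrite fsbig_finite//= set_fsetK sumEFin lee_fin.
rewrite -sum1_size -sumrMnr !big_seq ler_sum// => n nB.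
by rewrite mulr1n ge0_ler_powR ?nnegrE ?Bc// ltW.
Qed.

(** Chebyshev: m terms of size at least e contribute m e^r, which for large m exceeds the finite
    r-th power of the norm. *)
Lemma Lnorm_counting_fin_decay r u (e : R) : (0 < r)%R -> 'N_r%:E[u] < +oo ->
  (0 < e)%R -> finite_set [set n | (e <= `|u n|)%R].
Proof.
move=> r0 uoo e0; apply: contrapT => infA.
have Nr : 'N_r%:E[u] `^ r \is a fin_num.
  by rewrite fin_num_poweR// ge0_fin_numE// Lnorm_ge0.
have [m hm] : exists m : nat, (fine ('N_r%:E[u] `^ r) < (e `^ r) *+ m)%R.
  exists (Num.truncn (fine ('N_r%:E[u] `^ r) / e `^ r)).+1.
  rewrite -[ltRHS]mulr_natr mulrC -ltr_pdivrMr ?powR_gt0//.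
  exact: truncnS_gt.
have [B BA mB] := infinite_set_fset m infA.
have := @le_sum_Lnorm_counting r u e B r0 (ltW e0) BA.
rewrite -(fineK Nr) lee_fin leNgt (lt_le_trans hm)// ler_pMn2l ?powR_gt0//.
Qed.

(** For r > 1 this grows more slowly than the number of terms, which is what makes averages over
    disjoint blocks small. *)
Lemma Lnorm_counting_indic r (B : {fset nat}) : (0 < r)%R ->
  'N_r%:E[(fun n => (n \in B)%:R%R)] = ((#|` B|%:R) `^ r^-1)%:E.
Proof.
move=> r0.
apply: (poweR_inj r0); rewrite ?Lnorm_ge0 ?lee_fin ?powR_ge0//.
rewrite Lnorm_counting_powE// poweR_EFin -powRrM mulVf ?gt_eqF// powRr1//.
rewrite (esumID [set` B]) => [|n _]; last by rewrite lee_fin powR_ge0.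
rewrite setTI [X in _ + X](esum1 (D := setT `&` ~` [set` B])) ?adde0; last first.
  by move=> n [_ /= /negP/negPf ->]; rewrite normr0 powR0// gt_eqF.
rewrite esum_fset//.
rewrite fsbig_finite//= set_fsetK sumEFin -sum1_size natr_sum; congr (_%:E).
by rewrite !big_seq; apply: eq_bigr => n ->; rewrite normr1 powR1.
Qed.

(** A crude bound for small errors, uniform in p: Minkowski's inequality splits off the last
    entry. *)
Lemma Lnorm_counting_trunc_le p u (N : nat) (c : R) : 1 <= p ->
  (forall n, (n < N)%N -> 0 <= u n <= c)%R ->
  'N_p[(fun n => if (n < N)%N then u n else 0%R)] <= (c *+ N)%:E.
Proof.
move=> p1; have p0 : 0 < p by exact: lt_le_trans p1.
elim: N => [_|N IH uc].
  rewrite mulr0n le_eqVlt; apply/orP; left; apply/eqP.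
  by rewrite -(@Lnorm_counting_delta p 0 0 p0 (lexx _)); congr Lnorm;
    apply/funext => n /=; rewrite if_same.
have /andP[uN0 uNc] := uc _ (ltnSn N).
apply: (@le_trans _ _ 'N_p[((fun n => if (n < N)%N then u n else 0) \+
    (fun n => if n == N then u N else 0))%R]).
  apply: le_Lnorm_counting => // n; rewrite ltnS leq_eqVlt.
  have [->|/negPf nN] /= := eqVneq n N; first by rewrite eqxx ltnn add0r lexx uN0.
  rewrite nN.
  case: ifPn => [ltnN|]; rewrite addr0 lexx ?andbT//.
  by have /andP[] := uc _ (ltnW ltnN).
apply: le_trans; first exact: eminkowski.
rewrite mulrSr EFinD leeD//; last by rewrite Lnorm_counting_delta// lee_fin.
by apply: IH => n nN; apply: uc; exact: ltnW.
Qed.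

End Lnorm_sequences.

(** * Topology through the real-valued norm *)

Section rnorm_topology.
Variables (R : realType) (k : scalar_kind).
Local Notation K := (scalars R k).

(** A positive element of [K] is real even for complex scalars, so radii in [K] can be traded for
    radii in [R]. *)
Lemma scalar_pos (e : K) : 0 < e -> exists2 r : R, 0 < r & e = scalar_of k r.
Proof.
move=> e0; exists (scalar_re e); last by rewrite scalar_reK// ltW.
by rewrite -(ltr_scalar_of k) scalar_of0 scalar_reK// ltW.
Qed.

Lemma scalar_of_nat (n : nat) : scalar_of k n%:R = n%:R :> K.
Proof.
elim: n => [|n IH]; first by rewrite scalar_of0.
by rewrite -!natr1 scalar_ofD IH /scalar_of; case: k.
Qed.

Lemma ball_rnorm (V : normedModType K) (x y : V) (r : R) :
  ball x (scalar_of k r) y <-> rnorm (x - y) < r.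
Proof. by rewrite -ball_normE /= normr_rnorm ltr_scalar_of. Qed.

Lemma unit_ball_rnorm (V : normedModType K) (x : V) :
  unit_ball x <-> rnorm x <= 1.
Proof.
have e1 : scalar_of k 1 = 1 :> K := scalar_of_nat 1.
by rewrite /unit_ball/= -e1 normr_rnorm ler_scalar_of.
Qed.

Lemma nbhs_rnormP (V : normedModType K) (x : V) (A : set V) :
  nbhs x A <-> exists2 r : R, 0 < r & forall y, rnorm (x - y) < r -> A y.
Proof.
rewrite nbhs_ballP; split=> [[_ /scalar_pos[r r0 ->] xA]|[r r0 xA]].
  by exists r => // y /ball_rnorm; exact: xA.
exists (scalar_of k r); first by rewrite /= -(scalar_of0 R k) ltr_scalar_of.
by move=> y /ball_rnorm; exact: xA.
Qed.

Lemma cvg_rnormP T (F : set_system T) {FF : Filter F} (V : normedModType K)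
    (f : T -> V) (l : V) :
  f @ F --> l <-> forall r : R, 0 < r -> \forall x \near F, rnorm (l - f x) < r.
Proof.
split=> [fl r r0|fl A /nbhs_rnormP[r r0 rA]].
  by apply: (fl [set y | rnorm (l - y) < r]); apply/nbhs_rnormP; exists r.
by apply: filterS (fl r r0) => x; exact: rA.
Qed.

Lemma lipschitz_rnorm_continuous (V W : normedModType K) (f : V -> W) (C : R) :
  (forall x y, rnorm (f x - f y) <= C * rnorm (x - y)) -> continuous f.
Proof.
move=> fC x; apply/cvg_rnormP => r r0.
(* [|C| + 1] is a positive Lipschitz constant whatever the sign of [C]. *)
have C0 : 0 < `|C| + 1 by rewrite ltr_wpDl.
apply/nbhs_rnormP; exists (r / (`|C| + 1)); first by rewrite divr_gt0.
move=> y; rewrite ltr_pdivlMr// mulrC; apply: le_lt_trans.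
apply: le_trans (fC x y) _; rewrite ler_wpM2r ?rnorm_ge0//.
by rewrite (le_trans (ler_norm _))// lerDl.
Qed.

Lemma cauchy_ex_rnorm (V : normedModType K) (F : set_system V) :
  (forall r : R, 0 < r -> exists x, F [set y | rnorm (x - y) < r]) <-> cauchy_ex F.
Proof.
split=> [Fr _ /scalar_pos[r r0 ->]|Fr r r0].
  have [x Fx] := Fr r r0; exists x.
  by rewrite (_ : ball _ _ = [set y | rnorm (x - y) < r])//;
    apply/seteqP; split=> y /ball_rnorm.
have kr0 : 0 < scalar_of k r by rewrite -(scalar_of0 R k) ltr_scalar_of.
have [x Fx] := Fr _ kr0; exists x.
by rewrite (_ : [set _ | _] = ball x (scalar_of k r))//;
    apply/seteqP; split=> y /ball_rnorm.
Qed.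

Lemma compact_rnorm_cover (V : normedModType K) (A : set V) (r : R) :
  compact A -> 0 < r ->
  exists D : {fset V}, forall x, A x -> exists2 z, z \in D & rnorm (z - x) < r.
Proof.
rewrite compact_cover => cA r0.
have [|x Ax|D _ AD] := cA V A (fun z => [set x | rnorm (z - x) < r]).
- move=> z _; rewrite openE => x /= zx; apply/nbhs_rnormP.
  exists (r - rnorm (z - x)); first by rewrite subr_gt0.
  move=> y; rewrite ltrBrDl; apply: le_lt_trans.
  by rewrite -[z - y](subrKA x) ler_rnormD.
- by exists x => //=; rewrite subrr rnorm0.
- by exists D => x /AD[z zD zx]; exists z.
Qed.

(* A norm limit of compact operators into a complete space is compact: an
   ultrafilter on the closure of the image of the unit ball is Cauchy. *)
Lemma is_compact_op_approx (E : normedModType K) (F : completeNormedModType K)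
    (T : E -> F) : linear T ->
  (forall r : R, 0 < r -> exists2 S : E -> F, is_compact_op S &
     forall x, unit_ball x -> rnorm (T x - S x) < r) ->
  is_compact_op T.
Proof.
move=> linT TS; split=> //; rewrite precompactE compact_ultra => U UF UT.
suff /cauchy_cvg /cvg_ex[l Ul] : cauchy U.
  exists l; split=> //; apply: closed_closure => B /Ul UB.
  exact: filter_ex (filterI UT UB).
apply: cauchy_exP; apply/cauchy_ex_rnorm => r r0.
have r3 : 0 < r / 3 by rewrite divr_gt0.
have [S [_ [B SB [cB _]]] STr] := TS _ r3.
have [D BD] := compact_rnorm_cover cB r3.
(* Otherwise the ultrafilter avoids the r-balls around all the finitely many net points; but a point
   y of the closure is within r/3 of some T x, that is within r/3 of S x, and S x is within r/3 of a
   net point. *)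
apply: contrapT => nU.
have UD : U (\bigcap_(z in [set` D]) ~` [set y | rnorm (z - y) < r]).
  apply: filter_bigI => z _.
  by case: (in_ultra_setVsetC [set y | rnorm (z - y) < r] UF) => // Uz; case: nU; exists z.
have [y [Ty Dy]] := filter_ex (filterI UT UD).
have [|_ [[x x1 <-] /= yTx]] := Ty [set y' | rnorm (y - y') < r / 3].
  by apply/nbhs_rnormP; exists (r / 3).
have [z zD zSx] := BD (S x) (SB _ (ex_intro2 _ _ x x1 erefl)).
apply: (Dy z zD) => /=; rewrite -[z - y](subrKA (S x)).
apply: le_lt_trans (ler_rnormD _ _) _; rewrite -[S x - y](subrKA (T x)).
have := ler_rnormD (S x - T x) (T x - y); rewrite -(rnormN (S x - T x)).
rewrite -(rnormN (T x - y)) !opprB; have := STr x x1; lra.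
Qed.

End rnorm_topology.

(** * Blocks and completeness of $\ell_p(X)$ *)

Section ell_facts.
Variables (R : realType) (k : scalar_kind) (p : \bar R) (hp : (1 <= p)%E).
Variable X : normedModType (scalars R k).
Local Notation K := (scalars R k).
Local Notation E := (ell hp X).
Implicit Types x y : E.

Let p0 : (0 < p)%E. Proof. exact: lt_le_trans hp. Qed.

Lemma ell_rnormE x : (rnorm x)%:E = ell_enorm p x.
Proof. by rewrite -ell_normE; congr (_%:E); exact: scalar_ofK. Qed.

Lemma in_ell (u : nat -> X) (c : R) :
  (ell_enorm p u <= c%:E)%E -> u \in ell_pred hp.
Proof. by move=> uc; rewrite inE; apply: le_lt_trans uc (ltry _). Qed.

Lemma ell_ext x y : (forall n, x n = y n) -> x = y.
Proof. by move=> xy; apply/val_inj/funext. Qed.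

Lemma ellD x y n : (x + y) n = x n + y n. Proof. by []. Qed.
Lemma ellB x y n : (x - y) n = x n - y n. Proof. by []. Qed.
Lemma ellZ (a : K) x n : (a *: x) n = a *: x n. Proof. by []. Qed.

Lemma ell_rnorm_ge x n : rnorm (x n) <= rnorm x.
Proof.
rewrite -lee_fin ell_rnormE -[rnorm (x n)]ger0_norm ?rnorm_ge0//.
exact: (@ge_Lnorm_counting _ p (fun n => rnorm (x n))).
Qed.

(** A sequence of infinite norm is sent to the default value 0, whence the finite bounds required in
    the lemmas on [to_ell]. *)
Definition to_ell (u : nat -> X) : E := insubd 0 u.

Lemma to_ellE (u : nat -> X) (c : R) n : (ell_enorm p u <= c%:E)%E ->
  to_ell u n = u n.
Proof. by move=> /in_ell uE; rewrite [ell_val _](insubdK 0 uE). Qed.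

Lemma to_ell_rnorm (u : nat -> X) (c : R) : (ell_enorm p u <= c%:E)%E ->
  (rnorm (to_ell u))%:E = ell_enorm p u.
Proof.
move=> uc; rewrite ell_rnormE; congr ell_enorm; apply/funext => n.
exact: to_ellE uc.
Qed.

(* [Cantor.to_nat] splits the index set into countably many infinite blocks,
   which identifies $\ell_p(X)$ with $\ell_p(\ell_p(X))$. *)
Definition block n x : E := to_ell (fun j => x (Cantor.to_nat (n, j))).

Let block_le n x :
  (ell_enorm p (fun j => x (Cantor.to_nat (n, j))) <= (rnorm x)%:E)%E.
Proof.
rewrite ell_rnormE.
apply: (@Lnorm_counting_comp_inj _ p (fun i => rnorm (x i))
  (fun j => Cantor.to_nat (n, j))) => // i j /(congr1 Cantor.of_nat).
by rewrite !Cantor.cancel_of_to => -[].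
Qed.

Lemma blockE n x j : block n x j = x (Cantor.to_nat (n, j)).
Proof. exact: to_ellE (block_le n x). Qed.

Lemma block_rnorm n x : rnorm (block n x) <= rnorm x.
Proof. by rewrite -lee_fin (to_ell_rnorm (block_le n x)). Qed.

Lemma block_linear n : linear (block n).
Proof. by move=> a x y; apply: ell_ext => j; rewrite ellD ellZ !blockE. Qed.

HB.instance Definition _ n :=
  GRing.isLinear.Build K E E *:%R (block n) (block_linear n).

Definition assemble (y : nat -> E) (i : nat) : X :=
  y (Cantor.of_nat i).1 (Cantor.of_nat i).2.

(** [assemble] inverts the splitting into blocks; summing block by block shows that it preserves the
    norm, i.e. l_p(l_p(X)) = l_p(X) isometrically. *)
Lemma assemble_enorm (y : nat -> E) :
  ell_enorm p (assemble y) = 'N[counting]_p[EFin \o (fun n => rnorm (y n))]%E.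
Proof.
apply: Lnorm_counting_pair => // n; first exact: rnorm_ge0.
rewrite ell_rnormE; congr Lnorm; apply/funext => j /=.
by rewrite /assemble Cantor.cancel_of_to.
Qed.

Lemma assemble_block x : assemble (fun n => block n x) = x.
Proof.
apply/funext => i; rewrite /assemble blockE -[in RHS](Cantor.cancel_to_of i).
by case: (Cantor.of_nat i).
Qed.

Lemma block_to_ell_assemble (y : nat -> E) (c : R) n :
  ('N[counting]_p[EFin \o (fun n => rnorm (y n))] <= c%:E)%E ->
  block n (to_ell (assemble y)) = y n.
Proof.
rewrite -assemble_enorm => yc; apply: ell_ext => j.
by rewrite blockE (to_ellE _ yc) /assemble Cantor.cancel_of_to.
Qed.

Lemma ell_rnorm_block x :
  (rnorm x)%:E = 'N[counting]_p[EFin \o (fun n => rnorm (block n x))]%E.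
Proof. by rewrite -assemble_enorm assemble_block ell_rnormE. Qed.

Definition place n x : E := to_ell (assemble (fun m => if m == n then x else 0)).

Let place_le (n : nat) x :
  ('N[counting]_p[EFin \o (fun m : nat => rnorm (if m == n then x else 0%R))] =
   (rnorm x)%:E)%E.
Proof.
rewrite -(Lnorm_counting_delta n p0 (rnorm_ge0 x)); congr Lnorm.
by apply/funext => m /=; case: ifP => // _; rewrite rnorm0.
Qed.

Lemma place_rnorm n x : rnorm (place n x) = rnorm x.
Proof.
apply: EFin_inj; rewrite -(place_le n x) -assemble_enorm.
by apply: (@to_ell_rnorm _ (rnorm x)); rewrite assemble_enorm place_le.
Qed.

Lemma block_place m n x : block m (place n x) = if m == n then x else 0.
Proof. by apply: (block_to_ell_assemble (c := rnorm x)); rewrite place_le. Qed.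

Lemma block_inj x y : (forall n, block n x = block n y) -> x = y.
Proof.
move=> xy; apply/val_inj; rewrite /= -[LHS]assemble_block -[RHS]assemble_block.
by congr assemble; apply/funext.
Qed.

Lemma place_linear n : linear (place n).
Proof.
move=> a x y; apply: block_inj => m.
rewrite block_linear !block_place; case: ifP => // _.
by rewrite scaler0 addr0.
Qed.

HB.instance Definition _ n :=
  GRing.isLinear.Build K E E *:%R (place n) (place_linear n).

End ell_facts.

Section ell_complete.
Variables (R : realType) (k : scalar_kind) (p : \bar R) (hp : (1 <= p)%E).
Variable X : completeNormedModType (scalars R k).
Local Notation E := (ell hp X).

Let p0 : (0 < p)%E. Proof. exact: lt_le_trans hp. Qed.

(* The norm is a supremum of norms of finite truncations, hence lower
   semicontinuous for coordinatewise convergence. *)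
Lemma ell_enorm_le_cvg (F : set_system E) (y : nat -> X) (c : R) :
  ProperFilter F -> (forall n, (fun x : E => x n) @ F --> y n) ->
  (\forall x \near F, rnorm x <= c) -> (ell_enorm p y <= c%:E)%E.
Proof.
move=> FF Fy Fc; have c0 : 0 <= c.
  by have [x xc] := filter_ex Fc; exact: le_trans (rnorm_ge0 _) xc.
apply: Lnorm_counting_le_trunc => // N.
apply/lee_addgt0Pr => e e0.
(* N coordinate errors of this size add up to at most e; the successor keeps the quotient meaningful
   for N = 0. *)
have eN : 0 < e / N.+1%:R by rewrite divr_gt0.
have FN : F [set x | forall n, (n < N)%N -> rnorm (y n - x n) < e / N.+1%:R].
  have : F (\bigcap_(n in [set` [fset i in iota 0 N]%fset])
      [set x : E | rnorm (y n - x n) < e / N.+1%:R]).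
    by apply: filter_bigI => n _; have /cvg_rnormP := Fy n; exact.
  by apply: filterS => x Nx n nN; apply: Nx; rewrite /= !inE mem_iota.
have [x [xc xy]] := filter_ex (filterI Fc FN).
pose u n := if (n < N)%N then rnorm (y n - x n) else 0.
apply: (@le_trans _ _ 'N[counting]_p[EFin \o (u \+ (fun n => rnorm (x n)))%R]%E).
  apply: le_Lnorm_counting => // n; rewrite /= /u; case: ifP => _; rewrite ?add0r ?lexx ?rnorm_ge0//.
  by rewrite (le_trans _ (ler_rnormD _ _))// subrK.
apply: le_trans; first exact: eminkowski.
rewrite addeC leeD//; first by rewrite -lee_fin ell_rnormE in xc.
apply: le_trans (Lnorm_counting_trunc_le (c := e / N.+1%:R) _ _) _ => //.
  by move=> n nN; rewrite rnorm_ge0/= ltW// xy.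
by rewrite lee_fin -[leLHS]mulr_natr -mulrA ger_pMr// ler_pdivrMl// mulr1 ler_nat leqnSn.
Qed.

(** Coordinates are contractions, so F converges coordinatewise; lower semicontinuity of the norm
    turns this into norm convergence. *)
Lemma ell_complete (F : set_system E) : ProperFilter F -> cauchy F -> cvg F.
Proof.
move=> FF /cauchyP/cauchy_ex_rnorm Fc.
have Fn n : cvg ((fun x : E => x n) @ F).
  apply/cauchy_cvgP/cauchy_exP/cauchy_ex_rnorm => r r0.
  have [x Fx] := Fc r r0; exists (x n).
  suff : F [set y : E | rnorm (x n - y n) < r] by [].
  apply: filterS Fx => y /=; apply: le_lt_trans.
  exact: (ell_rnorm_ge (x - y) n).
pose y n := lim ((fun x : E => x n) @ F).
have zy (r : R) (z : E) : F [set x | rnorm (z - x) < r] ->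
    (ell_enorm p (fun n => y n - z n)%R <= r%:E)%E.
  move=> Fz; apply: (@ell_enorm_le_cvg ((fun x => x - z) @ F)).
    by move=> n; apply: cvgB; [exact: Fn|exact: cvg_cst].
  suff : F [set x : E | rnorm (x - z) <= r] by [].
  by apply: filterS Fz => x /= /ltW; rewrite -rnormN opprB.
have [z0 /zy z0y] := Fc 1 ltr01.
(* Only differences y - z are known to have finite norm, so the limit is built as (y - z0) + z0. *)
pose l := to_ell hp (fun n => y n - z0 n) + z0.
have lE n : l n = y n by rewrite ellD (to_ellE _ _ z0y) subrK.
apply/cvg_ex; exists l; apply/cvg_rnormP => r r0.
have r2 : 0 < r / 2 by rewrite divr_gt0.
have [z Fz] := Fc _ r2.
apply: filterS (Fz) => x /= zx; rewrite -[l - x](subrKA z).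
apply: le_lt_trans (ler_rnormD _ _) _; rewrite [ltRHS]splitr ler_ltD//.
rewrite -lee_fin ell_rnormE; apply: le_trans (zy _ _ Fz).
by rewrite le_eqVlt; apply/orP; left; apply/eqP; congr ell_enorm;
  apply/funext => n; rewrite ellB lE.
Qed.

HB.instance Definition _ := Uniform_isComplete.Build E ell_complete.

End ell_complete.

(** * Block diagonal operators *)

Section operator_norm.
Variables (R : realType) (k : scalar_kind).
Local Notation K := (scalars R k).
Variables E F : normedModType K.
Implicit Types S T : compact_op E F.

HB.instance Definition _ T :=
  GRing.isLinear.Build K E F *:%R (op_val T) (compact_opP T).1.

Lemma op_ext S T : S =1 T -> S = T.
Proof. by move=> ST; apply/val_inj/funext. Qed.

Lemma op_rnormE T : rnorm T = sup_rnorm (@unit_ball R k E) T.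
Proof. exact: scalar_ofK. Qed.

Lemma op_rnorm_le T (c : R) : 0 <= c ->
  (forall x, rnorm x <= 1 -> rnorm (T x) <= c) -> rnorm T <= c.
Proof.
move=> c0 Tc; rewrite op_rnormE; apply: sup_rnorm_le => // x /unit_ball_rnorm.
exact: Tc.
Qed.

Lemma op_rnorm_ge T x : rnorm (T x) <= rnorm T * rnorm x.
Proof.
have [->|x0] := eqVneq x 0; first by rewrite linear0 !rnorm0 mulr0.
have nx0 : 0 < rnorm x.
  rewrite lt_neqAle rnorm_ge0 andbT eq_sym.
  by apply: contra x0 => /eqP /rnorm0_eq0 ->.
have a0 : 0 <= scalar_of k (rnorm x)^-1.
  by rewrite -(scalar_of0 R k) ler_scalar_of invr_ge0 ltW.
have aE : scalar_re `|scalar_of k (rnorm x)^-1| = (rnorm x)^-1.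
  by rewrite ger0_norm// scalar_ofK.
have : rnorm (T (scalar_of k (rnorm x)^-1 *: x)) <= rnorm T.
  rewrite op_rnormE; apply: sup_rnorm_ub.
    exact: is_compact_op_bounded (compact_opP T).
  by apply/unit_ball_rnorm; rewrite rnormZ aE mulVf ?gt_eqF.
by rewrite linearZ rnormZ aE mulrC ler_pdivrMr.
Qed.

Definition to_op (T : E -> F) : compact_op E F := insubd 0 T.

Lemma to_opE (T : E -> F) x : is_compact_op T -> to_op T x = T x.
Proof. by move=> cT; rewrite [op_val _](insubdK 0)// inE. Qed.

End operator_norm.

(** The contraction [A] maps unit ball into unit ball, and the continuous map [B] preserves compact
    sets. *)
Lemma is_compact_op_comp (R : realType) (k : scalar_kind)
    (E E' F F' : normedModType (scalars R k))
    (A : E' -> E) (T : compact_op E F) (B : F -> F') :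
  linear A -> (forall x, rnorm (A x) <= rnorm x) -> linear B -> continuous B ->
  is_compact_op (fun x => B (T (A x))).
Proof.
move=> linA A1 linB cB; split=> [a x y|]; first by rewrite linA linearP linB.
have [_ [C TC [cC _]]] := compact_opP T.
have cBC : compact (B @` C) by apply: continuous_compact => //; exact: continuous_subspaceT.
exists (B @` C); last by split=> //; apply: compact_closed => //; exact: norm_hausdorff.
move=> _ [x /unit_ball_rnorm x1 <-]; exists (T (A x)) => //; apply: TC.
by exists (A x) => //; apply/unit_ball_rnorm; exact: le_trans x1.
Qed.

Section block_diagonal.
Variables (R : realType) (k : scalar_kind).
Variables (X : normedModType (scalars R k)) (Y : completeNormedModType (scalars R k)).
Variables (p q : \bar R) (hp : (1 <= p)%E) (hq : (1 <= q)%E).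
Local Notation K := (scalars R k).
Local Notation E := (ell hp X).
Local Notation F := (ell hq Y).
Local Notation Z := (compact_op E F).
Implicit Types (S : Z) (T : nat -> Z).

Lemma block_continuous (r : \bar R) (hr : (1 <= r)%E) (V : normedModType K) n :
  continuous (@block R k r hr V n).
Proof.
apply: (@lipschitz_rnorm_continuous _ _ _ _ _ 1) => x y.
by rewrite -raddfB mul1r block_rnorm.
Qed.

Lemma place_continuous (r : \bar R) (hr : (1 <= r)%E) (V : normedModType K) n :
  continuous (@place R k r hr V n).
Proof.
apply: (@lipschitz_rnorm_continuous _ _ _ _ _ 1) => x y.
by rewrite -raddfB mul1r place_rnorm.
Qed.

Definition diag_block S n : Z := to_op (fun x => block n (S (place n x))).

Lemma diag_blockE S n x : diag_block S n x = block n (S (place n x)).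
Proof.
apply: to_opE; apply: is_compact_op_comp => //.
- exact: place_linear.
- by move=> y; rewrite place_rnorm.
- exact: block_linear.
- exact: block_continuous.
Qed.

Lemma diag_blockP (a : K) S S' n :
  diag_block (a *: S + S') n = a *: diag_block S n + diag_block S' n.
Proof.
apply: op_ext => x; rewrite diag_blockE.
transitivity (a *: diag_block S n x + diag_block S' n x) => //.
by rewrite !diag_blockE -block_linear.
Qed.

Lemma diag_block_rnorm S n : rnorm (diag_block S n) <= rnorm S.
Proof.
apply: op_rnorm_le; first exact: rnorm_ge0.
move=> x x1; rewrite diag_blockE; apply: le_trans (block_rnorm _ _) _.
apply: le_trans (op_rnorm_ge _ _) _.
by rewrite place_rnorm ler_piMr ?rnorm_ge0.
Qed.

Definition diag_fun T (x : E) : F := to_ell hq (assemble (fun n => T n (block n x))).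

Definition diag_op T : Z := to_op (diag_fun T).

Hypothesis hpq : (p <= q)%E.

(* The inclusion of $\ell_p$ into $\ell_q$ is where [p <= q] enters. *)
Lemma diag_bound T (c : R) x : (forall n, rnorm (T n) <= c) ->
  ('N[counting]_q[EFin \o (fun n => rnorm (T n (block n x)))] <=
   (c * rnorm x)%:E)%E.
Proof.
move=> Tc; have c0 : 0 <= c := le_trans (rnorm_ge0 _) (Tc 0).
have p0 : (0 < p)%E := lt_le_trans lte01 hp.
have q0 : (0 < q)%E := lt_le_trans lte01 hq.
apply: le_trans (le_Lnorm_counting (v := fun n => c * rnorm (block n x)) q0 _) _.
  move=> n; rewrite rnorm_ge0/=; apply: le_trans (op_rnorm_ge _ _) _.
  by rewrite ler_wpM2r// rnorm_ge0.
rewrite Lnorm_countingZ// EFinM lee_wpmul2l// ell_rnorm_block.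
exact: Lnorm_counting_mono.
Qed.

Lemma block_diag_fun T (c : R) n x : (forall n, rnorm (T n) <= c) ->
  block n (diag_fun T x) = T n (block n x).
Proof. by move=> Tc; apply: block_to_ell_assemble; exact: diag_bound Tc. Qed.

Lemma diag_fun_rnorm T (c : R) x : (forall n, rnorm (T n) <= c) ->
  rnorm (diag_fun T x) <= c * rnorm x.
Proof.
move=> Tc; rewrite -lee_fin; have := diag_bound x Tc.
rewrite -assemble_enorm => Tx.
by rewrite (to_ell_rnorm _ Tx).
Qed.

Lemma diag_fun_linear T (c : R) : (forall n, rnorm (T n) <= c) ->
  linear (diag_fun T).
Proof.
move=> Tc a x y; apply: block_inj => n.
by rewrite block_linear !(block_diag_fun _ _ Tc) block_linear linearP.
Qed.

Let trunc N T n := if (n < N)%N then T n else 0.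

Let trunc_bound N T (c : R) : (forall n, rnorm (T n) <= c) ->
  forall n, rnorm (trunc N T n) <= c.
Proof.
move=> Tc n; rewrite /trunc; case: ifP => // _.
by rewrite rnorm0; exact: le_trans (rnorm_ge0 _) (Tc 0).
Qed.

(** By induction this is a finite sum of compositions of [block n], [T n] and [place n], each of
    them compact. *)
Lemma diag_fun_trunc_compact T (c : R) N : (forall n, rnorm (T n) <= c) ->
  is_compact_op (diag_fun (trunc N T)).
Proof.
move=> Tc; elim: N => [|N IH].
  rewrite (_ : diag_fun _ = 0); first by have [] := compact_op_submod_closed E F; rewrite inE.
  apply/funext => x; apply: block_inj => n.
  rewrite (block_diag_fun _ _ (trunc_bound 0 Tc)) /trunc ltn0.
  by apply: ell_ext => j; rewrite blockE.
have cN : is_compact_op (fun x => place N (T N (block N x))).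
  apply: is_compact_op_comp.
  - exact: block_linear.
  - by move=> y; exact: block_rnorm.
  - exact: place_linear.
  - exact: place_continuous.
have [_ /(_ 1 (fun x => place N (T N (block N x))) (diag_fun (trunc N T)))] :=
  compact_op_submod_closed E F.
rewrite !inE => /(_ cN IH); rewrite (_ : _ + _ = diag_fun (trunc N.+1 T))//.
apply/funext => x; apply: block_inj => n.
rewrite [X in block n X](_ : _ = 1 *: place N (T N (block N x)) + diag_fun (trunc N T) x)//.
rewrite block_linear scale1r block_place.
rewrite !(block_diag_fun _ _ (trunc_bound _ Tc)) /trunc ltnS (leq_eqVlt n N).
have [->|nN] /= := eqVneq n N; last by rewrite add0r.
by rewrite ltnn addr0.
Qed.

Lemma cvg0_rnorm_bounded (V : normedModType K) (z : nat -> V) :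
  z @ \oo --> (0 : V) -> exists c : R, forall n, rnorm (z n) <= c.
Proof.
move=> /cvg_rnormP/(_ 1 ltr01)[N _ Nz].
(* The tail is bounded by 1 and each of the first N terms by their sum. *)
exists (1 + \sum_(i < N) rnorm (z i)) => n.
have S0 (P : pred 'I_N) : 0 <= \sum_(i < N | P i) rnorm (z i).
  by apply: sumr_ge0 => i _; exact: rnorm_ge0.
have [nN|nN] := ltnP n N.
  by rewrite (bigD1 (Ordinal nN))//= addrCA lerDl addr_ge0// ?ler01.
by have := Nz n nN; rewrite sub0r rnormN => /ltW /le_trans; apply; rewrite lerDl.
Qed.

(** The tail beyond N is again block diagonal, of norm at most the supremum of the remaining norms,
    so the operator is a norm limit of its truncations. *)
Lemma diag_fun_compact T : T @ \oo --> (0 : Z) -> is_compact_op (diag_fun T).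
Proof.
move=> T0; have [c Tc] := cvg0_rnorm_bounded T0.
apply: is_compact_op_approx; first exact: diag_fun_linear Tc.
move=> r r0; have r2 : 0 < r / 2 by rewrite divr_gt0.
have /cvg_rnormP/(_ _ r2)[N _ NT] := T0.
exists (diag_fun (trunc N T)); first exact: diag_fun_trunc_compact Tc.
move=> x /unit_ball_rnorm x1.
pose T' n := if (n < N)%N then 0 else T n.
have T'r n : rnorm (T' n) <= r / 2.
  rewrite /T'; case: ltnP => nN; first by rewrite rnorm0 ltW.
  by have := NT n nN; rewrite sub0r rnormN => /ltW.
rewrite (_ : _ - _ = diag_fun T' x).
  apply: le_lt_trans (diag_fun_rnorm x T'r) _.
  rewrite (@le_lt_trans _ _ (r / 2))//; last by rewrite gtr_pMr// invf_lt1// ltr1n.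
  by rewrite ler_piMr// ltW.
apply: block_inj => n; rewrite -scaleN1r addrC block_linear scaleN1r.
rewrite (block_diag_fun _ _ Tc) (block_diag_fun _ _ T'r).
rewrite (block_diag_fun _ _ (trunc_bound _ Tc)) /T' /trunc.
by case: ifP => _; rewrite ?oppr0 ?add0r// addrC subrr.
Qed.

Lemma diag_opE T x : T @ \oo --> (0 : Z) -> diag_op T x = diag_fun T x.
Proof. by move=> T0; apply: to_opE; exact: diag_fun_compact. Qed.

Lemma block_diag_op T n x : T @ \oo --> (0 : Z) ->
  block n (diag_op T x) = T n (block n x).
Proof.
move=> T0; have [c Tc] := cvg0_rnorm_bounded T0.
by rewrite diag_opE// (block_diag_fun _ _ Tc).
Qed.

Lemma diag_op_rnorm T (c : R) : T @ \oo --> (0 : Z) ->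
  (forall n, rnorm (T n) <= c) -> rnorm (diag_op T) <= c.
Proof.
move=> T0 Tc; have c0 : 0 <= c := le_trans (rnorm_ge0 _) (Tc 0).
apply: op_rnorm_le => // x x1; rewrite diag_opE//.
by apply: le_trans (diag_fun_rnorm x Tc) _; rewrite ler_piMr.
Qed.

Lemma diag_opP (a : K) T T' : T @ \oo --> (0 : Z) -> T' @ \oo --> (0 : Z) ->
  diag_op (fun n => a *: T n + T' n) = a *: diag_op T + diag_op T'.
Proof.
move=> T0 T'0; apply: op_ext => x.
transitivity (a *: diag_op T x + diag_op T' x) => //.
apply: block_inj => n; rewrite block_linear !block_diag_op//.
rewrite -[X in _ --> X](addr0 (0 : Z)) -[X in _ --> X + _](scaler0 _ a).
by apply: cvgD => //; exact: cvgZl_tmp.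
Qed.

(** Hence [diag_op] embeds c_0(Z) in Z with left inverse [diag_block], and its range is complemented
    once diagonal blocks are known to form null sequences. *)
Lemma diag_opK T n : T @ \oo --> (0 : Z) -> diag_block (diag_op T) n = T n.
Proof.
move=> T0; apply: op_ext => x.
by rewrite diag_blockE block_diag_op// block_place eqxx.
Qed.

End block_diagonal.

(** * Diagonal blocks of compact operators *)

Section diagonal_blocks_vanish.
Variables (R : realType) (k : scalar_kind).
Local Notation K := (scalars R k).

(** Pigeonhole: the finitely many balls of a net cannot each catch only finitely many indices of
    [A]. *)
Lemma compact_infinite_ball (V : normedModType K) (B : set V) (A : set nat)
    (u : nat -> V) (r : R) : compact B -> infinite_set A ->
  (forall n, A n -> B (u n)) -> 0 < r ->
  exists z, infinite_set (A `&` [set n | rnorm (z - u n) < r]).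
Proof.
move=> cB infA Bu r0; have [D BD] := compact_rnorm_cover cB r0.
apply: contrapT => /forallNP fin; apply: infA.
apply: (@sub_finite_set _ _
    (\bigcup_(z in [set` D]) (A `&` [set n | rnorm (z - u n) < r]))).
  by move=> n An; have [z zD zn] := BD _ (Bu n An); exists z.
by apply: bigcup_finite => // z _; exact: contrapT (fin z).
Qed.

Lemma infinite_nat_not_near (P : set nat) :
  ~ (\forall n \near \oo, ~ P n) -> infinite_set P.
Proof.
move=> nP finP; apply: nP.
have /finite_fsetP[D PD] := finP.
exists (\max_(i <- D) i).+1 => // n /= nD Pn.
have nin : n \in D by have : [set` D] n by rewrite -PD.
by move: nD; rewrite ltnNge (@leq_bigmax_seq _ _ (fun=> true) id)//.
Qed.

Variables (X Y : normedModType K) (p : R) (q : \bar R).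
Variables (hp : (1 <= p%:E)%E) (hq : (1 <= q)%E).
Local Notation E := (ell hp X).
Local Notation F := (ell hq Y).
Implicit Type S : compact_op E F.

Let p0 : (0 < p)%R. Proof. by move: (hp); rewrite lee_fin; exact: lt_le_trans. Qed.

(** The summands live in distinct blocks, so the sequence of block norms is dominated by the
    indicator of [B]. *)
Lemma sum_place_rnorm (B : {fset nat}) (x : nat -> E) :
  (forall n, n \in B -> rnorm (x n) <= 1) ->
  rnorm (\sum_(n <- B) place n (x n)) <= #|` B|%:R `^ p^-1.
Proof.
move=> x1; rewrite -lee_fin -Lnorm_counting_indic// ell_rnorm_block.
apply: le_Lnorm_counting => [|m]; first by rewrite lte_fin.
rewrite rnorm_ge0/= raddf_sum /=.
under eq_bigr do rewrite block_place.
have [mB|mB] := boolP (m \in B).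
  rewrite (big_fsetD1 m)//= eqxx big_seq big1 ?addr0 ?x1// => n.
  by rewrite !inE eq_sym => /andP[/negPf ->].
rewrite big_seq big1 ?rnorm0// => n nB.
by case: eqP => // mn; rewrite mn nB in mB.
Qed.

Lemma exists_powR_gt (a t : R) : 0 < t -> exists m : nat, a < m%:R `^ t.
Proof.
move=> t0; exists (Num.truncn (`|a| `^ t^-1)).+1.
apply: le_lt_trans (ler_norm a) _.
have {1}-> : `|a| = (`|a| `^ t^-1) `^ t by rewrite -powRrM mulVf ?gt_eqF// powRr1.
by apply: gt0_ltr_powR => //; rewrite ?nnegrE ?powR_ge0//; exact: truncnS_gt.
Qed.

(* Unit vectors in disjoint blocks of $\ell_p$, [p > 1], have averages tending
   to 0, so their images under S cannot accumulate away from 0. *)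
Lemma small_cluster_domain S (x : nat -> E) (A : set nat) (z : F) (r : R) :
  1 < p -> infinite_set A -> (forall n, A n -> rnorm (x n) <= 1) ->
  (forall n, A n -> rnorm (z - S (place n (x n))) < r) -> rnorm z <= r + r.
Proof.
move=> p1 infA x1 zr; rewrite leNgt; apply/negP => rz.
have [n0 An0] : A !=set0 by apply/set0P; apply: contra_notN infA => /eqP ->.
have r0 : 0 < r := le_lt_trans (rnorm_ge0 _) (zr n0 An0).
have t0 : 0 < 1 - p^-1 by rewrite subr_gt0 invf_lt1.
(* This size of m makes |S| m^(1/p) < r m, so the images of the block vectors average to less than
   r. *)
have [m hm] := exists_powR_gt (rnorm S / r) t0.
have [B BA mB] := infinite_set_fset m infA.
have B0 : (0 : R) <= #|` B|%:R by [].
have {}hm : rnorm S / r < #|` B|%:R `^ (1 - p^-1).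
  apply: lt_le_trans hm _; apply: ge0_ler_powR; rewrite ?nnegrE ?ler_nat//.
  exact: ltW.
have Bp : (0 : R) < #|` B|%:R.
  rewrite lt_neqAle B0 andbT eq_sym; apply: contraTneq hm => ->.
  by rewrite powR0 ?gt_eqF// -leNgt divr_ge0 ?rnorm_ge0// ltW.
have sumz : rnorm (\sum_(n <- B) (z - S (place n (x n)))) <= r *+ #|` B|.
  rewrite -sum1_size -sumrMnr !big_seq.
  elim/big_ind2 : _ => [|u v u' v' uv uv'|n nB]; first by rewrite rnorm0.
    by apply: le_trans (ler_rnormD _ _) _; exact: lerD.
  by rewrite mulr1n ltW// zr//; exact: BA.
have sumS : rnorm (\sum_(n <- B) S (place n (x n))) <= rnorm S * #|` B|%:R `^ p^-1.
  rewrite -raddf_sum; apply: le_trans (op_rnorm_ge _ _) _.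
  by rewrite ler_wpM2l ?rnorm_ge0// sum_place_rnorm// => n nB; apply: x1; exact: BA.
(* Write |B| z as the sum of the differences z - S(...) plus the sum of the images S(...). *)
have zB : rnorm z * #|` B|%:R <= r * #|` B|%:R + rnorm S * #|` B|%:R `^ p^-1.
  have -> : rnorm z * #|` B|%:R = rnorm (\sum_(n <- B) z).
    rewrite big_const_seq count_predT iter_addr addr0 -[z *+ _]scaler_nat rnormZ mulrC.
    by rewrite normr_nat -scalar_of_nat scalar_ofK.
  rewrite mulr_natr; apply: le_trans (lerD sumz sumS).
  by apply: le_trans (ler_rnormD _ _); rewrite sumrB subrK.
have B1 : (1 == p^-1) ==> (#|` B|%:R != 0 :> R) by rewrite (gt_eqF Bp) implybT.
move: hm; rewrite (powRB B1) powRr1// ltr_pdivrMr//.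
rewrite mulrAC ltr_pdivlMr ?powR_gt0// => hm.
have : rnorm z * #|` B|%:R < (r + r) * #|` B|%:R.
  by apply: le_lt_trans zB _; rewrite mulrDl ltrD2l [ltRHS]mulrC.
by rewrite ltr_pM2r// ltNge (ltW rz).
Qed.

(** For finite q the blocks of the fixed vector z tend to 0, so some n in [A] has [block n z] small;
    [block n] does not enlarge u n - z. *)
Lemma small_cluster_range (u : nat -> F) (A : set nat) (z : F) (r : R) :
  (q < +oo)%E -> infinite_set A -> 0 < r ->
  (forall n, A n -> rnorm (z - u n) < r) ->
  exists2 n, A n & rnorm (block n (u n)) < r + r.
Proof.
move=> qoo infA r0 zr.
have [s qs] : exists s, q = s%:E by case: (q) (hq) qoo => // s; exists s.
have s0 : 0 < s by move: (hq); rewrite qs lee_fin; exact: lt_le_trans.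
have finz : finite_set [set n | r <= `|rnorm (block n z)|].
  apply: (@Lnorm_counting_fin_decay _ s (fun n => rnorm (block n z))) => //.
  by rewrite -qs -ell_rnorm_block ltry.
have [n [An /negP]] := infinite_setN0 (infinite_setD infA finz).
rewrite -ltNge ger0_norm ?rnorm_ge0// => nz; exists n => //.
rewrite -[u n](subrK z) raddfD /=; apply: le_lt_trans (ler_rnormD _ _) _.
rewrite ltrD//; apply: le_lt_trans (block_rnorm _ _) _.
by rewrite -rnormN opprB zr.
Qed.

End diagonal_blocks_vanish.

(** Otherwise infinitely many diagonal blocks have norm at least r. Almost norming vectors, placed
    in their blocks, have images under S that cluster by compactness; p > 1 or finite q rules this
    out. *)
Lemma diag_block_cvg0 (R : realType) (k : scalar_kind)
    (X : normedModType (scalars R k)) (Y : completeNormedModType (scalars R k))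
    (p : R) (q : \bar R) (hp : (1 <= p%:E)%E) (hq : (1 <= q)%E)
    (S : compact_op (ell hp X) (ell hq Y)) :
  1 < p \/ (q < +oo)%E ->
  diag_block S @ \oo --> (0 : compact_op (ell hp X) (ell hq Y)).
Proof.
move=> pq; apply/cvg_rnormP => r r0; apply: contrapT => nr.
pose A := [set n | r <= rnorm (diag_block S n)].
have infA : infinite_set A.
  apply: infinite_nat_not_near; apply: contra_not nr; apply: filterS => n.
  by rewrite /A/= sub0r rnormN ltNge => /negP.
have r2 : r / 2 < r by rewrite gtr_pMr// invf_lt1// ltr1n.
(* The factor r / 2 leaves room for a vector nearly attaining the norm; outside [A] the vector 0
   serves. *)
have /choice[x xP] n : exists x : ell hp X, rnorm x <= 1 /\
    (A n -> r / 2 < rnorm (block n (S (place n x)))).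
  apply: contrapT => /forallNP nx.
  have An : A n by apply: contrapT => nA; apply: (nx 0); rewrite rnorm0.
  have : rnorm (diag_block S n) <= r / 2.
    apply: op_rnorm_le => [|x x1]; first by rewrite divr_ge0// ltW.
    rewrite diag_blockE leNgt; apply/negP => rx; exact: (nx x).
  by rewrite leNgt (lt_le_trans r2 An).
have [_ [B SB [cB _]]] := compact_opP S.
(* For p > 1, |z| <= r/3 and a further r/6 gives at most r/2; for finite q a block gets norm below
   r/3. Both contradict the choice of x. *)
have r6 : 0 < r / 6 by rewrite divr_gt0.
have [|z infz] := compact_infinite_ball (u := fun n => S (place n (x n))) cB infA _ r6.
  move=> n _; apply: SB; exists (place n (x n)) => //.
  by apply/unit_ball_rnorm; rewrite place_rnorm; have [] := xP n.
case: pq => [p1|qoo].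
- have zr : rnorm z <= r / 6 + r / 6.
    apply: (small_cluster_domain (S := S) (x := x) p1 infz) => n [An]//.
    by have [] := xP n.
  have [n [An /= zn]] := infinite_setN0 infz.
  have := (xP n).2 An; have := block_rnorm n (S (place n (x n))).
  have := ler_rnormD (S (place n (x n)) - z) z.
  rewrite subrK -(rnormN (_ - z)) opprB; lra.
- have [n [An _]] := small_cluster_range (u := fun n => S (place n (x n)))
    qoo infz r6 (fun n => @proj2 _ _).
  by have := (xP n).2 An; lra.
Qed.

(** * Pelczynski decomposition for $C([1,\omega])$ *)

Section one_to_omega.
Local Notation T := (order_topology itv_1_omega).

Lemma omega_in_itv : omega \in `[finite_ordinal 1, omega]%O. Proof. by []. Qed.

Lemma finite_in_itv n : finite_ordinal n.+1 \in `[finite_ordinal 1, omega]%O.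
Proof. by []. Qed.

Definition top_point : T := exist _ omega omega_in_itv.

(** The shift matches indices starting at 0 with ordinals starting at 1. *)
Definition point_at n : T := exist _ (finite_ordinal n.+1) (finite_in_itv n).

Lemma itv_1_omegaP (t : T) : t = top_point \/ exists n, t = point_at n.
Proof.
case: t => [[[|n]|] tP] //.
- by right; exists n; apply: val_inj.
- by left; apply: val_inj.
Qed.

Lemma nbhs_top_point (A : set T) :
  nbhs top_point A -> \forall n \near \oo, A (point_at n).
Proof.
rewrite itv_nbhsE => -[[l r] [oi /andP[lw wr]] iA].
have {}iA x : (l <= BLeft x)%O -> A x.
  by move=> lx; apply/iA/andP; split=> //; apply: le_trans wr; case: x {lx} => [[n|] ?].
case: l lw oi iA => [[] c|[]] lw oi iA.
- by case: r oi {wr} => [[]|[]].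
- case: c lw {oi} iA => [[m|] cP] // lw iA.
  exists m => // n /= mn; apply: iA; rewrite bnd_simp /=.
  by rewrite ltNge /= -ltnNge ltnS.
- by exists 0 => // n _; apply: iA.
- by [].
Qed.

(** The point is cut out by the open rays below its successor and above its predecessor; the first
    point has no predecessor and needs only the former. *)
Lemma nbhs_point_at n : nbhs (point_at n) [set point_at n].
Proof.
have lt_pt i j : (point_at i < point_at j)%O = (i < j)%N.
  by rewrite ltNge /= -ltnNge ltnS.
have gt1 : nbhs (point_at n) [set t : T | (t < point_at n.+1)%O].
  have := @lray_open _ T (point_at n.+1); rewrite openE => /(_ (point_at n)).
  by rewrite /= !in_itv /= lt_pt ltnSn => /(_ isT); apply: filterS => t /=; rewrite in_itv.
have lt1 : nbhs (point_at n) [set t : T | (point_at n <= t)%O].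
  case: n gt1 => [|n] _; first by apply: filterS filterT => -[[[|t]|] ?].
  have := @rray_open _ T (point_at n); rewrite openE => /(_ (point_at n.+1)).
  rewrite /= !in_itv /= andbT lt_pt ltnSn => /(_ isT); apply: filterS => t /=.
  rewrite in_itv /= andbT; have [->|[m ->]] := itv_1_omegaP t => //.
  by rewrite lt_pt.
apply: filterS (filterI lt1 gt1) => t /= [].
have [->|[m ->]] := itv_1_omegaP t; first by [].
by rewrite lt_pt leNgt lt_pt -leqNgt ltnS => nm mn; congr point_at; apply/anti_leq/andP.
Qed.

(** Finite ordinals are isolated, so only omega matters, and there the rays above the points
    [point_at N] are neighbourhoods. *)
Lemma continuous_1_omega (U : topologicalType) (f : T -> U) :
  continuous f <-> (fun n => f (point_at n)) @ \oo --> f top_point.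
Proof.
split=> [cf A /cf /nbhs_top_point//|cf t].
have [->|[n ->]] := itv_1_omegaP t; last first.
  by move=> A /nbhs_singleton An; apply: filterS (nbhs_point_at n) => _ ->.
move=> A fA; have [N _ NA] := cf A fA.
have := @rray_open _ T (point_at N); rewrite openE => /(_ top_point).
rewrite /= in_itv /= => /(_ isT); apply: filterS => u /=.
rewrite in_itv /= andbT; have [->|[m ->]] := itv_1_omegaP u => Nm.
  exact: nbhs_singleton fA.
by apply: NA => /=; move: Nm; rewrite ltNge /= -ltnNge ltnS => /ltnW.
Qed.

End one_to_omega.

Section cfun_norm.
Variables (R : realType) (k : scalar_kind) (S : topologicalType).
Variables (cS : compact [set: S]) (E : normedModType (scalars R k)).
Implicit Type f : cfun cS E.

Lemma cfun_rnormE f : rnorm f = sup_rnorm [set: S] f.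
Proof. exact: scalar_ofK. Qed.

Lemma cfun_rnorm_ge f x : rnorm (f x) <= rnorm f.
Proof.
rewrite cfun_rnormE; apply: sup_rnorm_ub => //.
have [|M fM] := @compact_rnorm_bounded _ _ _ (f @` [set: S]).
  by apply: continuous_compact => //; exact/continuous_subspaceT/cfunP.
by exists M => y _; apply: fM; exists y.
Qed.

Lemma cfun_rnorm_le f (c : R) : 0 <= c -> (forall x, rnorm (f x) <= c) ->
  rnorm f <= c.
Proof. by move=> c0 fc; rewrite cfun_rnormE; exact: sup_rnorm_le. Qed.

End cfun_norm.

(* Pelczynski decomposition: if the null sequences of Z form a complemented
   subspace D(c_0(Z)) of Z, then the complement Q(Z) can be shifted along them. *)
Section decomposition.
Variables (R : realType) (k : scalar_kind) (Z : normedModType (scalars R k)).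
Local Notation K := (scalars R k).
Local Notation null z := (z @ \oo --> (0 : Z)).
Variables (P : Z -> nat -> Z) (D : (nat -> Z) -> Z).
Hypothesis P_linear : forall n a x y, P (a *: x + y) n = a *: P x n + P y n.
Hypothesis P_rnorm : forall x n, rnorm (P x n) <= rnorm x.
Hypothesis P_null : forall x, null (P x).
Hypothesis D_linear : forall a z z', null z -> null z' ->
  D (fun n => a *: z n + z' n) = a *: D z + D z'.
Hypothesis D_rnorm : forall z c, null z -> (forall n, rnorm (z n) <= c) ->
  rnorm (D z) <= c.
Hypothesis DK : forall z n, null z -> P (D z) n = z n.

(** [J] is the projection onto the copy D(c_0(Z)) of c_0(Z), and [Q] the complementary
    projection. *)
Let J x := D (P x).
Let Q x := x - J x.

Let J_linear : linear J.
Proof.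
move=> a x y; rewrite /J -D_linear//; congr D.
by apply/funext => n; exact: P_linear.
Qed.

HB.instance Definition _ := GRing.isLinear.Build K Z Z *:%R J J_linear.

Let Q_linear : linear Q.
Proof. by move=> a x y; rewrite /Q linearP scalerBr opprD addrACA. Qed.

HB.instance Definition _ := GRing.isLinear.Build K Z Z *:%R Q Q_linear.

Let PE x y : (forall n, P x n = P y n) -> J x = J y.
Proof. by move=> xy; congr D; apply/funext. Qed.

Let JJ x : J (J x) = J x.
Proof. by apply: PE => n; rewrite DK. Qed.

Let QJ x : Q (J x) = 0. Proof. by rewrite /Q JJ subrr. Qed.
Let JQ x : J (Q x) = 0. Proof. by rewrite raddfB /= JJ subrr. Qed.
Let QQ x : Q (Q x) = Q x. Proof. by rewrite {1}/Q JQ subr0. Qed.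
Let JQE x : J x + Q x = x. Proof. by rewrite addrC /Q subrK. Qed.

Let J_rnorm x : rnorm (J x) <= rnorm x.
Proof. exact: D_rnorm. Qed.

Let Q_rnorm x : rnorm (Q x) <= 2 * rnorm x.
Proof.
apply: le_trans (ler_rnormD _ _) _.
by rewrite rnormN mulr2n mulrDl mul1r lerD2l.
Qed.

Let J_null z : null z -> null (J \o z).
Proof.
move=> /cvg_rnormP z0; apply/cvg_rnormP => r /z0; apply: filterS => n.
by rewrite !sub0r !rnormN; apply: le_lt_trans; exact: J_rnorm.
Qed.

Let Q_null z : null z -> null (Q \o z).
Proof. by move=> z0; rewrite -[0]subr0; apply: cvgB => //; exact: J_null. Qed.

(** The isomorphism of Z onto c_0(Z): x amounts to Q x and the null sequence P x; the Q-parts of P x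
    move one place to the right, and Q x fills the freed place 0. *)
Let shift x n := if n is m.+1 then J (P x m.+1) + Q (P x m) else J (P x 0) + Q x.

(** The inverse: the Q-parts move back to the left, and Q (z 0) returns to the complement. *)
Let unshift z := D (fun n => J (z n) + Q (z n.+1)) + Q (z 0).

Let shift_null x : null (shift x).
Proof.
rewrite -(cvg_shiftS (shift x)) /=.
rewrite -[0]addr0; apply: cvgD; last exact: Q_null.
by have := J_null (@P_null x); rewrite -(cvg_shiftS (J \o P x)).
Qed.

Let unshift_null z : null z -> null (fun n => J (z n) + Q (z n.+1)).
Proof.
move=> z0; rewrite -[0]addr0; apply: cvgD; first exact: J_null.
by have := Q_null z0; rewrite -(cvg_shiftS (Q \o z)).
Qed.

Let shiftK x : unshift (shift x) = x.
Proof.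
rewrite /unshift (_ : (fun n => _) = P x).
  by rewrite /shift raddfD /= QJ QQ add0r JQE.
apply/funext => n; have -> : J (shift x n) = J (P x n).
  by case: n => [|n]; rewrite /= raddfD /= JJ JQ addr0.
by rewrite /= raddfD /= QJ QQ add0r JQE.
Qed.

Let P_unshift z n : null z -> P (unshift z) n = J (z n) + Q (z n.+1).
Proof.
move=> z0; rewrite /unshift -[D _]scale1r P_linear scale1r DK//; last exact: unshift_null.
(* P vanishes on the complement, since P (D (P x)) = P x. *)
suff -> : P (Q (z 0)) n = 0 by rewrite addr0.
by rewrite /Q addrC -scaleN1r P_linear DK// scaleN1r addrC subrr.
Qed.

Let unshiftK z n : null z -> shift (unshift z) n = z n.
Proof.
move=> z0; have JPu m : J (P (unshift z) m) = J (z m).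
  by rewrite P_unshift// raddfD /= JJ JQ addr0.
case: n => [|n] /=; rewrite JPu.
  rewrite [Q _](_ : _ = Q (z 0)) ?JQE// /unshift raddfD /= QQ.
  suff -> : Q (D (fun n => J (z n) + Q (z n.+1))) = 0 by rewrite add0r.
  rewrite /Q /J (_ : P (D _) = fun n => J (z n) + Q (z n.+1)) ?subrr//.
  by apply/funext => n; rewrite DK//; exact: unshift_null.
by rewrite P_unshift// raddfD /= QJ QQ add0r JQE.
Qed.

Let shift_linear n a x y : shift (a *: x + y) n = a *: shift x n + shift y n.
Proof. by case: n => [|n] /=; rewrite !P_linear !linearP scalerDr addrACA. Qed.

Let shift_rnorm x n : rnorm (shift x n) <= 3 * rnorm x.
Proof.
have JP m : rnorm (J (P x m)) <= rnorm x by exact: le_trans (J_rnorm _) (P_rnorm _ _).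
have QP m : rnorm (Q (P x m)) <= 2 * rnorm x.
  by apply: le_trans (Q_rnorm _) _; rewrite ler_wpM2l.
by case: n => [|n] /=; apply: le_trans (ler_rnormD _ _) _;
  rewrite (natrD _ 1 2) mulrDl mul1r lerD.
Qed.

(** The constant is (1 + 2) + 2, from the bounds 1 for [J] and 2 for [Q]. *)
Let unshift_rnorm z c : null z -> (forall n, rnorm (z n) <= c) ->
  rnorm (unshift z) <= 5 * c.
Proof.
move=> z0 zc; have Qc n : rnorm (Q (z n)) <= 2 * c.
  by apply: le_trans (Q_rnorm _) _; rewrite ler_wpM2l.
apply: le_trans (ler_rnormD _ _) _; rewrite (natrD _ 3 2) mulrDl lerD//.
apply: D_rnorm => [|n]; first exact: unshift_null.
apply: le_trans (ler_rnormD _ _) _; rewrite (natrD _ 1 2) mulrDl mul1r lerD//.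
exact: le_trans (J_rnorm _) (zc n).
Qed.

Local Notation C := (cfun compact_1_omega Z).

(* A convergent sequence is coded by its limit followed by its distances to
   the limit. *)
Let to_fun x (t : order_topology itv_1_omega) : Z :=
  if val t is Some n then shift x n + shift x 0 else shift x 0.

Let to_fun_in x : to_fun x \in cfun_pred compact_1_omega.
Proof.
rewrite inE; apply/continuous_1_omega.
rewrite -[X in _ --> X]add0r; apply: cvgD; last exact: cvg_cst.
by rewrite (cvg_shiftS (shift x)).
Qed.

Let to_cfun x : C := CFun (to_fun_in x).

(** Entry 0 holds the limit; entry m+1 belongs to the ordinal m+1, which is [point_at m]. *)
Let of_cfun (h : C) : Z :=
  unshift (fun n => if n is m.+1 then h (point_at m) - h top_point else h top_point).

Let of_cfun_null (h : C) :
  null (fun n => if n is m.+1 then h (point_at m) - h top_point else h top_point).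
Proof.
have /continuous_1_omega hc := @cfunP _ _ _ compact_1_omega _ h.
rewrite -cvg_shiftS /= -(subrr (h top_point)).
by apply: cvgB => //; exact: cvg_cst.
Qed.

Let to_cfun_linear : linear to_cfun.
Proof.
move=> a x y; apply/val_inj/funext => t.
have -> : \val (a *: to_cfun x + to_cfun y) t = a *: to_fun x t + to_fun y t by [].
rewrite /= /to_fun; case: (val t) => [n|]; rewrite !shift_linear//.
by rewrite addrACA -scalerDr.
Qed.

HB.instance Definition _ := GRing.isLinear.Build K Z C *:%R to_cfun to_cfun_linear.

Let to_cfunK : cancel to_cfun of_cfun.
Proof.
move=> x; rewrite -[RHS]shiftK; congr unshift.
by apply/funext => -[|n] //; exact: addrK.
Qed.

Let of_cfunK : cancel of_cfun to_cfun.
Proof.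
move=> h; apply/val_inj/funext => t.
have [->|[n ->]] := itv_1_omegaP t; first exact: unshiftK 0 (of_cfun_null h).
transitivity (shift (of_cfun h) n.+1 + shift (of_cfun h) 0) => //.
rewrite (unshiftK 0 (of_cfun_null h)) (unshiftK n.+1 (of_cfun_null h)).
exact: subrK.
Qed.

Lemma isomorphic_cfun_1_omega : isomorphic Z C.
Proof.
exists to_cfun, of_cfun; split=> //.
- apply: (@lipschitz_rnorm_continuous _ _ _ _ _ 6) => x y.
  rewrite -raddfB; set z := x - y.
  have z6 : 3 * rnorm z + 3 * rnorm z = 6 * rnorm z by rewrite -mulrDl -natrD.
  apply: cfun_rnorm_le => [|t]; first by rewrite mulr_ge0 ?rnorm_ge0.
  rewrite /= /to_fun; case: (val t) => [n|]; rewrite -z6.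
    by apply: le_trans (ler_rnormD _ _) _; rewrite lerD.
  by rewrite (le_trans (shift_rnorm _ _))// lerDl mulr_ge0 ?rnorm_ge0.
- apply: (@lipschitz_rnorm_continuous _ _ _ _ _ 10) => h h'.
  (* Additivity of [of_cfun] is inherited from its linear inverse [to_cfun]. *)
  have -> : of_cfun h - of_cfun h' = of_cfun (h - h').
    by rewrite -[in RHS](of_cfunK h) -[in RHS](of_cfunK h') -raddfB to_cfunK.
  (* Differences from the limit cost a factor 2, and [unshift] a factor 5. *)
  rewrite (natrM _ 5 2) -mulrA.
  apply: unshift_rnorm; first exact: of_cfun_null.
  have h2 t : rnorm ((h - h') t) <= rnorm (h - h') by exact: cfun_rnorm_ge.
  case=> [|n]; rewrite mulr2n mulrDl mul1r.
    by rewrite (le_trans (h2 _))// lerDl rnorm_ge0.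
  by apply: le_trans (ler_rnormD _ _) _; rewrite rnormN lerD.
Qed.

End decomposition.

Theorem theorem5p3 (R : realType) (k : scalar_kind)
    (X Y : completeNormedModType (scalars R k)) (p : R) (q : \bar R)
    (hp : (1 <= p%:E)%E) (hpq : (p%:E <= q)%E)
    (hpq1 : (p%:E, q) <> (1%E, +oo%E)) :
  isomorphic
    (compact_op (ell hp X) (ell (le_trans hp hpq) Y))
    (cfun compact_1_omega (compact_op (ell hp X) (ell (le_trans hp hpq) Y))).
Proof.
(* Excluding (1, +oo) leaves exactly the two cases in which diagonal blocks vanish. *)
have pq : 1 < p \/ (q < +oo)%E.
  have [p1|] := eqVneq p 1; last by left; rewrite lt_neqAle eq_sym -lee_fin hp andbT.
  right; rewrite ltey; apply/eqP => qoo; apply: hpq1.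
  by rewrite p1 qoo.
apply: (isomorphic_cfun_1_omega (P := @diag_block _ _ _ _ _ _ _ _)
  (D := @diag_op _ _ _ _ _ _ _ _)).
- by move=> n a S T; exact: diag_blockP.
- by move=> S n; exact: diag_block_rnorm.
- by move=> S; exact: diag_block_cvg0.
- by move=> a S T; exact: diag_opP.
- by move=> T c; exact: diag_op_rnorm.
- by move=> T n; exact: diag_opK.
Qed.
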